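(* Let $d\ge1$ be an integer. (i) For all functions $f\in L^1(\mathcal S_d)$ and all $\beta\in[0,d]$, $$\dim_{\mathcal P}\big(\mathcal E^+_{\rm HF}(\beta,f)\big)\le d-\beta .$$ (ii) There exists a nonnegative function $f\in L^1(\mathcal S_d)$ such that, for all $\beta\in[0,d]$, $$\dim_{\mathcal H}\big(E_{\rm HF}(\beta,f)\big)=\dim_{\mathcal P}\big(E_{\rm HF}(\beta,f)\big)=d-\beta .$$ In particular, $\dim_{\mathcal P}\big(E^+_{\rm HF}(\beta,f)\big)=d-\beta$ for all $\beta\in[0,d]$.
   Context: $\mathcal S_d$ (resp. $B_{d+1}$) is the Euclidean unit sphere (resp. unit ball) of $\mathbb R^{d+1}$ and $d\sigma$ is the normalized Lebesgue measure on $\mathcal S_d$. For $f\in L^1(\mathcal S_d)$, its Poisson integral is the harmonic function on $B_{d+1}$ $$P[f](x)=\int_{\mathcal S_d}P(x,\xi)f(\xi)\,d\sigma(\xi),\qquad P(x,\xi)=\frac{1-\|x\|^2}{\|x-\xi\|^{d+1}} .$$ $\dim_{\mathcal H}$ and $\dim_{\mathcal P}$ denote Hausdorff and packing dimension (the empty set has dimension $0$), and $\log0=-\infty$. For $x\in\mathcal S_d$, $\beta^-_{\rm HF}(x)$ is the infimum of the real numbers $\beta$ such that $P[f](rx)=O((1-r)^{-\beta})$ as $r\to1^-$, i.e. $\beta^-_{\rm HF}(x)=\limsup_{r\to1}\frac{\log|P[f](rx)|}{-\log(1-r)}$, and $\beta^+_{\rm HF}(x)$ is the supremum of the real numbers $\beta$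 such that $(1-r)^{-\beta}=O(P[f](rx))$ as $r\to1^-$, i.e. $\beta^+_{\rm HF}(x)=\liminf_{r\to1}\frac{\log|P[f](rx)|}{-\log(1-r)}$. For $\beta\ge0$, $$\mathcal E^+_{\rm HF}(\beta,f)=\{x\in\mathcal S_d:\ \beta^+_{\rm HF}(x)\ge\beta\},\qquad E^+_{\rm HF}(\beta,f)=\{x\in\mathcal S_d:\ \beta^+_{\rm HF}(x)=\beta\},$$ $$E_{\rm HF}(\beta,f)=\{x\in\mathcal S_d:\ \beta^+_{\rm HF}(x)=\beta^-_{\rm HF}(x)=\beta\}.$$ *)

(* Defs.v *)
From HB Require Import structures.
From mathcomp Require Import all_boot all_order all_algebra.
From mathcomp Require Import all_classical all_reals all_analysis.
From mathcomp Require Import measurable_realfun.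

Set Implicit Arguments.
Unset Strict Implicit.
Unset Printing Implicit Defensive.
Import Order.TTheory GRing.Theory Num.Theory.
Import numFieldNormedType.Exports.

Local Open Scope classical_set_scope.
Local Open Scope ring_scope.

(* Row vectors carry the sigma-algebra generated by the coordinates (the
   construction the library uses for tuples).  Since R is second countable, it
   is the Borel sigma-algebra of R^n. *)
Fact rV_display : measure_display. Proof. exact: default_measure_display. Qed.

Section measurable_rV.
Variables (R : realType) (n : nat).

Let coors : 'I_n -> 'rV[R]_n -> R := fun i x => x ord0 i.

Let rV_set0 : g_sigma_preimage coors set0.
Proof. exact: sigma_algebra0. Qed.

Let rV_setC A : g_sigma_preimage coors A -> g_sigma_preimage coors (~` A).
Proof. exact: sigma_algebraC. Qed.

Let rV_bigcup (F : _^nat) : (forall i, g_sigma_preimage coors (F i)) ->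
  g_sigma_preimage coors (\bigcup_i (F i)).
Proof. exact: sigma_algebra_bigcup. Qed.

HB.instance Definition _ := @isMeasurable.Build rV_display
  'rV[R]_n (g_sigma_preimage coors) rV_set0 rV_setC rV_bigcup.

End measurable_rV.

Section measurable_fun_rV.
Context (R : realType).

Lemma measurable_coord n (i : 'I_n) :
  measurable_fun [set: 'rV[R]_n] (fun x => x ord0 i).
Proof.
move=> _ Y mY; rewrite setTI; apply: sub_sigma_algebra => /=.
rewrite -bigcup_seq/=; exists i => /=; first by rewrite mem_index_enum.
by exists Y => //; rewrite setTI.
Qed.

Lemma measurable_fun_rV d (T : measurableType d) n (f : T -> 'rV[R]_n) :
  (forall i, measurable_fun [set: T] (fun t => f t ord0 i)) ->
  measurable_fun [set: T] f.
Proof.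
move=> mf _ A mA; rewrite setTI.
suff : preimage_set_system [set: T] f measurable `<=` measurable.
  by apply; exists A => //; rewrite setTI.
rewrite -[X in X `<=` _]g_sigma_preimage_comp.
apply: smallest_sub; first exact: sigma_algebra_measurable.
rewrite -bigcup_seq; apply: bigcup_sub => i _ B [C mC <-].
exact: (mf i).
Qed.

End measurable_fun_rV.

(* Lebesgue measure on R^n, as the iterated product of the Lebesgue measure on
   R along R * R^n ~ R^n.+1. *)
Definition consrow (R : realType) n (p : R * 'rV[R]_n) : 'rV[R]_n.+1 :=
  row_mx (p.1%:M : 'rV[R]_1) p.2.

Fixpoint rV_lebesgue (R : realType) n : set 'rV[R]_n -> \bar R :=
  match n with
  | 0 => \d_(0 : 'rV[R]_0)
  | n'.+1 => pushforward (@lebesgue_measure R \x @rV_lebesgue R n')%E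
               (@consrow R n')
  end.

Section rV_lebesgue_is_measure.
Context (R : realType).

Lemma consrow0 n (p : R * 'rV[R]_n) : consrow p ord0 ord0 = p.1.
Proof.
rewrite /consrow.
have -> : (ord0 : 'I_n.+1) = lshift n (ord0 : 'I_1) by apply/val_inj.
by rewrite (@row_mxEl _ 1 1 n) mxE.
Qed.

Lemma consrowS n (p : R * 'rV[R]_n) (i : 'I_n) :
  consrow p ord0 (lift ord0 i) = p.2 ord0 i.
Proof.
rewrite /consrow.
have -> : lift ord0 i = rshift 1 i by apply/val_inj.
by rewrite (@row_mxEr _ 1 1 n).
Qed.

Definition unconsrow n (x : 'rV[R]_n.+1) : R * 'rV[R]_n :=
  (x ord0 ord0, \row_i x ord0 (lift ord0 i)).

Lemma consrowK n : cancel (@consrow R n) (@unconsrow n).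
Proof.
case=> a u; rewrite /unconsrow consrow0; congr pair.
by apply/rowP => i; rewrite mxE consrowS.
Qed.

Lemma measurable_consrow n : measurable_fun [set: _] (@consrow R n).
Proof.
apply: measurable_fun_rV => i; case: (unliftP ord0 i) => [j|] ->.
- rewrite (_ : (fun t => _) = (fun x : 'rV[R]_n => x ord0 j) \o snd); last first.
    by apply/funext => p /=; rewrite consrowS.
  by apply: measurableT_comp => //; exact: measurable_coord.
- rewrite (_ : (fun t => _) = fst) //.
  by apply/funext => p /=; rewrite consrow0.
Qed.

Lemma measurable_unconsrow n : measurable_fun [set: _] (@unconsrow n).
Proof.
apply: measurable_fun_pair; first exact: measurable_coord.
apply: measurable_fun_rV => i.
by under eq_fun do rewrite mxE; exact: measurable_coord.
Qed.

Section step.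
Variables (n : nat) (m : {sigma_finite_measure set 'rV[R]_n -> \bar R}).

Let step := pushforward (@lebesgue_measure R \x m)%E (@consrow R n).

Let step0 : step set0 = 0%E.
Proof. by rewrite /step /pushforward preimage_set0 measure0. Qed.

Let step_ge0 A : (0 <= step A)%E.
Proof. by rewrite /step /pushforward; exact: measure_ge0. Qed.

Let step_sigma_additive : semi_sigma_additive step.
Proof.
have mf := @measurable_consrow n.
move=> F mF tF mUF; rewrite /step /pushforward preimage_bigcup.
apply: measure_semi_sigma_additive.
- by move=> k; rewrite -[X in measurable X]setTI; exact: mf.
- apply/trivIsetP => i j _ _ ij; rewrite -preimage_setI.
  by move/trivIsetP : tF => /(_ _ _ _ _ ij) ->//; rewrite preimage_set0.
- by rewrite -preimage_bigcup -[X in measurable X]setTI; exact: mf.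
Qed.

HB.instance Definition _ := isMeasure.Build _ _ _ step
  step0 step_ge0 step_sigma_additive.

Let step_sigma_finite : sigma_finite setT step.
Proof.
have /sigma_finiteP[F [FT ndF Foo]] := sigma_finiteT (@lebesgue_measure R).
have /sigma_finiteP[G [GT ndG Goo]] := sigma_finiteT m.
exists (fun k => @unconsrow n @^-1` (F k `*` G k)).
  rewrite -preimage_bigcup (_ : \bigcup_k _ = setT) ?preimage_setT//.
  apply/seteqP; split => // -[x y] _.
  have [i _ Fx] : (\bigcup_k F k) x by rewrite -FT.
  have [j _ Gy] : (\bigcup_k G k) y by rewrite -GT.
  exists (maxn i j) => //; split => /=.
    by move: x Fx; exact/subsetPset/ndF/leq_maxl.
  by move: y Gy; exact/subsetPset/ndG/leq_maxr.
move=> k; have [mF Fk] := Foo k; have [mG Gk] := Goo k; split.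
  rewrite -[X in measurable X]setTI; apply: measurable_unconsrow => //.
  exact: measurableX.
rewrite /step /pushforward -comp_preimage (_ : _ \o _ = id); last first.
  by apply/funext => p /=; rewrite consrowK.
by rewrite preimage_id product_measure1E// lte_mul_pinfty// ge0_fin_numE.
Qed.

HB.instance Definition _ := Measure_isSigmaFinite.Build _ _ _ step
  step_sigma_finite.

Lemma rV_lebesgue_step :
  exists m' : {sigma_finite_measure set 'rV[R]_n.+1 -> \bar R},
    m' = step :> (set _ -> \bar R).
Proof. by exists step. Qed.

End step.

Lemma rV_lebesgue_ex n :
  exists m : {sigma_finite_measure set 'rV[R]_n -> \bar R},
    m = @rV_lebesgue R n :> (set _ -> \bar R).
Proof.
elim: n => [|n [m mE]]; first by exists \d_(0 : 'rV[R]_0).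
by have [m' m'E] := rV_lebesgue_step m; exists m'; rewrite m'E /= mE.
Qed.

Section instances.
Variable n : nat.

Let leb0 : @rV_lebesgue R n set0 = 0%E.
Proof. by have [m <-] := rV_lebesgue_ex n. Qed.

Let leb_ge0 A : (0 <= @rV_lebesgue R n A)%E.
Proof. by have [m <-] := rV_lebesgue_ex n. Qed.

Let leb_sigma_additive : semi_sigma_additive (@rV_lebesgue R n).
Proof.
have [m <-] := rV_lebesgue_ex n; exact: measure_semi_sigma_additive.
Qed.

HB.instance Definition _ := isMeasure.Build _ _ _ (@rV_lebesgue R n)
  leb0 leb_ge0 leb_sigma_additive.

Let leb_sigma_finite : sigma_finite setT (@rV_lebesgue R n).
Proof. by have [m <-] := rV_lebesgue_ex n; exact: sigma_finiteT. Qed.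

HB.instance Definition _ := Measure_isSigmaFinite.Build _ _ _ (@rV_lebesgue R n)
  leb_sigma_finite.

End instances.

End rV_lebesgue_is_measure.

(* The library's norm on row vectors is the sup norm. *)
Definition enorm (R : realType) n (x : 'rV[R]_n) : R :=
  Num.sqrt (\sum_i x ord0 i ^+ 2).

Definition esphere (R : realType) n : set 'rV[R]_n := [set x | enorm x = 1].
Arguments esphere : clear implicits.

Definition eclosed_ball (R : realType) n (x : 'rV[R]_n) (r : R) : set 'rV[R]_n :=
  [set y | enorm (y - x) <= r].

(* { t xi | 0 < t <= 1, xi in A } for A included in the sphere *)
Definition econe (R : realType) n (A : set 'rV[R]_n) : set 'rV[R]_n :=
  [set x | 0 < enorm x <= 1 /\ A ((enorm x)^-1 *: x)].

(* Normalized Lebesgue measure on the sphere, in polar coordinates: the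
   relative volume, in the unit ball, of the cone over A.  It is a measure on
   R^n that is concentrated on the sphere. *)
Definition sphere_measure (R : realType) n (A : set 'rV[R]_n) : \bar R :=
  ((fine (rV_lebesgue (eclosed_ball (0 : 'rV[R]_n) 1)))^-1%:E
     * rV_lebesgue (econe A))%E.
Arguments sphere_measure : clear implicits.

Section sphere_measure_is_measure.
Context (R : realType) (n : nat).

Lemma measurable_enorm : measurable_fun [set: 'rV[R]_n] (@enorm R n).
Proof.
apply: (@measurableT_comp _ _ _ _ _ _ (@Num.sqrt R)).
  by apply: continuous_measurable_fun; exact: sqrt_continuous.
apply: measurable_sum => i; apply: measurable_funX.
exact: measurable_coord.
Qed.

Lemma measurable_econe (A : set 'rV[R]_n) : measurable A -> measurable (econe A).
Proof.
move=> mA; rewrite (_ : econe A =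
  (@enorm R n @^-1` `]0, 1]) `&` ((fun x => (enorm x)^-1 *: x) @^-1` A)); last first.
  by apply/seteqP; split => x /=; rewrite in_itv.
apply: measurableI.
  by rewrite -[X in measurable X]setTI; exact: measurable_enorm.
rewrite -[X in measurable X]setTI.
suff : measurable_fun setT (fun x : 'rV[R]_n => (enorm x)^-1 *: x) by apply.
apply: measurable_fun_rV => i; under eq_fun do rewrite mxE.
apply: measurable_funM; last exact: measurable_coord.
under eq_fun do rewrite -powR_inv1 ?sqrtr_ge0//.
apply: (@measurableT_comp _ _ _ _ _ _ (@powR R ^~ (-1))).
  exact: measurable_powR.
exact: measurable_enorm.
Qed.

Let sm0 : sphere_measure R n set0 = 0%E.
Proof.
rewrite /sphere_measure (_ : econe _ = set0) ?measure0 ?mule0//.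
by apply/seteqP; split => x // [].
Qed.

Let inv_ge0 :
  0 <= (fine (rV_lebesgue (eclosed_ball (0 : 'rV[R]_n) 1)))^-1.
Proof. by rewrite invr_ge0 fine_ge0. Qed.

Let sm_ge0 A : (0 <= sphere_measure R n A)%E.
Proof. by rewrite mule_ge0// lee_fin. Qed.

Let sm_sigma_additive : semi_sigma_additive (sphere_measure R n).
Proof.
move=> F mF tF mUF.
have E : econe (\bigcup_k F k) = \bigcup_k econe (F k).
  apply/seteqP; split => x /=.
    by move=> [x1 [k _ Fk]]; exists k.
  by move=> [k _ [x1 Fk]]; split => //; exists k.
rewrite /sphere_measure E.
rewrite [X in X @ _ --> _](_ : _ = (fun k =>
   (fine (rV_lebesgue (eclosed_ball (0 : 'rV[R]_n) 1)))^-1%:E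
     * \sum_(0 <= i < k) rV_lebesgue (econe (F i)))%E); last first.
  by apply/funext => k; rewrite ge0_sume_distrr.
apply: cvgeZl => //; apply: measure_semi_sigma_additive.
- by move=> k; exact: measurable_econe.
- apply/trivIsetP => i j _ _ ij; apply/seteqP; split => x // [[_ Fi] [_ Fj]].
  move/trivIsetP : tF => /(_ _ _ I I ij) Fij.
  by have : (F i `&` F j) ((enorm x)^-1 *: x) by []; rewrite Fij.
- by rewrite -E; exact: measurable_econe.
Qed.

HB.instance Definition _ := isMeasure.Build _ _ _ (sphere_measure R n)
  sm0 sm_ge0 sm_sigma_additive.

End sphere_measure_is_measure.

Section fractal_dimensions.
Context (R : realType) (n : nat).
Implicit Types (E U : set 'rV[R]_n) (s delta : R).

Definition ediam U : \bar R :=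
  ereal_sup [set (enorm (x - y))%:E | x in U & y in U].

(* diam(U)^s, where the empty set counts for 0 even if s = 0 *)
Definition diam_gauge s U : \bar R :=
  (if `[< U = set0 >] then 0 else ediam U `^ s)%E.

Definition hausdorff_premeasure s delta E : \bar R :=
  ereal_inf [set (\sum_(0 <= i <oo) diam_gauge s (U i))%E
            | U in [set U : (set 'rV[R]_n)^nat |
                      (forall i, (ediam (U i) <= delta%:E)%E) /\
                      E `<=` \bigcup_i U i]].

Definition hausdorff_measure s E : \bar R :=
  ereal_sup [set hausdorff_premeasure s delta E | delta in [set t : R | 0 < t]].

Definition hausdorff_dim E : \bar R :=
  ereal_inf [set s%:E | s in [set s : R | 0 <= s /\ hausdorff_measure s E = 0%E]].

(* a countable family (indexed by I) of pairwise disjoint closed balls of radii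
   at most delta centered in E *)
Definition is_packing delta E (I : set nat) (x : nat -> 'rV[R]_n)
    (r : nat -> R) : Prop :=
  (forall i, I i -> E (x i) /\ 0 < r i <= delta) /\
  trivIset I (fun i => eclosed_ball (x i) (r i)).

Definition packing_premeasure_at s delta E : \bar R :=
  ereal_sup [set t : \bar R | exists I x r, is_packing delta E I x r /\
               t = (\esum_(i in I) ((2 * r i) `^ s)%:E)%E].

Definition packing_premeasure s E : \bar R :=
  ereal_inf [set packing_premeasure_at s delta E | delta in [set t : R | 0 < t]].

Definition packing_measure s E : \bar R :=
  ereal_inf [set (\sum_(0 <= i <oo) packing_premeasure s (F i))%E
            | F in [set F : (set 'rV[R]_n)^nat | E `<=` \bigcup_i F i]].

Definition packing_dim E : \bar R :=
  ereal_inf [set s%:E | s in [set s : R | 0 <= s /\ packing_measure s E = 0%E]].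

End fractal_dimensions.

Section poisson.
Context (R : realType) (d : nat).
Implicit Types (f : 'rV[R]_d.+1 -> R) (x xi : 'rV[R]_d.+1) (beta : R).

(* Functions on the sphere are represented by functions on R^(d+1), of which
   only the restriction to the sphere matters. *)
Definition L1_sphere f : Prop :=
  (sphere_measure R d.+1).-integrable (esphere R d.+1) (EFin \o f).

Definition poisson_kernel x xi : R :=
  (1 - enorm x ^+ 2) / enorm (x - xi) ^+ d.+1.

Definition poisson_integral f x : R :=
  \int[sphere_measure R d.+1]_(xi in esphere R d.+1) (poisson_kernel x xi * f xi).

(* log |P[f](rx)| / - log(1 - r), with log 0 = -oo *)
Definition growth_ratio f x (r : R) : \bar R :=
  (lne `|poisson_integral f (r *: x)|%:E * ((- ln (1 - r))^-1)%:E)%E.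

Definition beta_minus f x : \bar R := limf_esup (growth_ratio f x) 1^'-.

Definition beta_plus f x : \bar R := limf_einf (growth_ratio f x) 1^'-.

Definition level_set_plus_ge beta f : set 'rV[R]_d.+1 :=
  [set x | esphere R d.+1 x /\ (beta%:E <= beta_plus f x)%E].

Definition level_set_plus beta f : set 'rV[R]_d.+1 :=
  [set x | esphere R d.+1 x /\ beta_plus f x = beta%:E].

Definition level_set beta f : set 'rV[R]_d.+1 :=
  [set x | [/\ esphere R d.+1 x, beta_plus f x = beta%:E
             & beta_minus f x = beta%:E]].

End poisson.

(* Main.v *)
Require Import Defs.
From mathcomp Require Import all_boot all_order all_algebra.
From mathcomp Require Import all_classical all_reals all_analysis.
From mathcomp Require Import measurable_realfun.
From mathcomp Require Import ring lra zify.
Import Order.TTheory GRing.Theory Num.Theory.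
Import numFieldNormedType.Exports.
Set Implicit Arguments.
Unset Strict Implicit.
Unset Printing Implicit Defensive.
Local Open Scope classical_set_scope.
Local Open Scope ring_scope.

(** Part (i). For disjoint balls B(x_i, r_i) centred on the sphere, the sum over i
    of r_i^(d+e) P((1-r_i) x_i, xi) is bounded uniformly in xi, as one sees by
    grouping the balls according to the dyadic size of r_i + |x_i - xi|.
    Integrating against |f|, the sum of r_i^(d+e) |P[f]((1-r_i) x_i)| is at most
    C ||f||_1, so where |P[f]((1-r)x)| >= r^(-b) the packing premeasure of any
    exponent larger than d-b vanishes.

    Part (ii). For th in [0,1] let K_th be the set of points of the sphere whose
    coordinates in a chart have binary digits that are free at the positions k
    where the integer part of k th jumps and are 0 elsewhere; up to generation n
    only polynomially many such patterns exist.  Let f be the sum over n, with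
    weights of order n^(-2), of normalized indicators of the 2^(-n)-neighbourhoods
    of all approximations of generation n.  Then P[f]((1-r)x) >= r^(-b+o(1)) on
    K_th for b = d(1-th).  By the same packing estimate, the points where
    P[f]((1-r)x) >= r^(-b-eta) for some r of order 2^(-n) are covered by about
    2^(n(d-b-eta)) balls of radius 2^(-n), so by Borel-Cantelli they are
    negligible for the natural measure on K_th, which has Frostman exponent d-b.
    Hence E(b,f) contains almost all of K_th, and its Hausdorff dimension is at
    least d-b. *)

(** * The Euclidean norm and cubes *)

(** The extra [e] in [r_i^(d+e)] pays for the dyadic grouping: with [e = 0] each of the unboundedly
    many shells could contribute the same amount, while [r_i^e] makes the contributions geometric. A
    dimension does not see an arbitrarily small [e].

    A single [f] has to serve a continuum of values of [th], which is why patterns are counted: up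
    to generation [n] the slope [th] may be replaced by a fraction with numerator and denominator at
    most [n]. So [(n+1)^2] patterns suffice, and sharing the mass among them costs a factor
    polynomial in [n], invisible to growth exponents.

    The upper bound on the growth cannot hold everywhere on [K_th]: the parameter 0 is coded by the
    same point for all [th], and there the exponent is at least [d]. Hence the detour through almost
    every point. The natural measure on [K_th] is never built. It is replaced by Lebesgue measure on
    the cube of parameters, and preimages are only enclosed in cubes, because decoding is Hoelder of
    exponent [th]; measurability of the coding is thereby avoided. *)

Section euclidean_norm.
Context (R : realType) (n : nat).
Implicit Types (x y z : 'rV[R]_n) (a r : R).

Lemma enorm_ge0 x : 0 <= enorm x. Proof. exact: sqrtr_ge0. Qed.

Lemma sqr_enorm x : enorm x ^+ 2 = \sum_i x ord0 i ^+ 2.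
Proof. by rewrite sqr_sqrtr// sumr_ge0// => i _; rewrite sqr_ge0. Qed.

Lemma enormZ a x : enorm (a *: x) = `|a| * enorm x.
Proof.
rewrite /enorm -sqrtr_sqr -sqrtrM ?sqr_ge0//; congr Num.sqrt.
by rewrite mulr_sumr; apply: eq_bigr => i _; rewrite mxE exprMn.
Qed.

Lemma enormN x : enorm (- x) = enorm x.
Proof. by rewrite -scaleN1r enormZ normrN1 mul1r. Qed.

Lemma enorm_distC x y : enorm (x - y) = enorm (y - x).
Proof. by rewrite -opprB enormN. Qed.

Lemma enorm_eq0 x : enorm x = 0 -> x = 0.
Proof.
move=> x0; apply/rowP => i; rewrite mxE.
have : \sum_i x ord0 i ^+ 2 = 0 by rewrite -sqr_enorm x0 expr0n.
move/eqP; rewrite psumr_eq0; last by move=> j _; rewrite sqr_ge0.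
by move/allP => /(_ i); rewrite mem_index_enum sqrf_eq0 => /(_ isT)/eqP.
Qed.

(* Cauchy-Schwarz, from [2 x_i y_i <= (B/A) x_i^2 + (A/B) y_i^2] *)
Lemma dot_le_enorm x y : \sum_i x ord0 i * y ord0 i <= enorm x * enorm y.
Proof.
have [x0|x0] := eqVneq (enorm x) 0.
  rewrite x0 mul0r (enorm_eq0 x0) big1// => i _; by rewrite mxE mul0r.
have [y0|y0] := eqVneq (enorm y) 0.
  rewrite y0 mulr0 (enorm_eq0 y0) big1// => i _; by rewrite mxE mulr0.
have xp : 0 < enorm x by rewrite lt_neqAle eq_sym x0 enorm_ge0.
have yp : 0 < enorm y by rewrite lt_neqAle eq_sym y0 enorm_ge0.
set A := enorm x in x0 xp *; set B := enorm y in y0 yp *.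
have -> : A * B = \sum_i (B / A / 2 * x ord0 i ^+ 2 + A / B / 2 * y ord0 i ^+ 2).
  rewrite big_split/= -!mulr_sumr -!sqr_enorm -/A -/B; field.
  by rewrite x0 y0.
apply: ler_sum => i _; set u := x _ _; set v := y _ _.
rewrite -subr_ge0.
have -> : B / A / 2 * u ^+ 2 + A / B / 2 * v ^+ 2 - u * v =
  (B * u - A * v) ^+ 2 / (2 * A * B) by field; rewrite x0 y0.
by rewrite divr_ge0 ?sqr_ge0// !mulr_ge0// ltW.
Qed.

Lemma ler_enormD x y : enorm (x + y) <= enorm x + enorm y.
Proof.
rewrite -(@ler_pXn2r _ 2)// ?nnegrE ?addr_ge0 ?enorm_ge0//.
rewrite sqr_enorm sqrrD !sqr_enorm.
have -> : \sum_i (x + y) ord0 i ^+ 2 = \sum_i x ord0 i ^+ 2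
   + (\sum_i x ord0 i * y ord0 i) *+ 2 + \sum_i y ord0 i ^+ 2.
  rewrite -sumrMnl -!big_split/=; apply: eq_bigr => i _.
  by rewrite mxE sqrrD.
by rewrite lerD2r lerD2l lerMn2r/= dot_le_enorm.
Qed.

Lemma ler_enorm_dist y x z : enorm (x - z) <= enorm (x - y) + enorm (y - z).
Proof. by rewrite -[x - z](subrKA y) ler_enormD. Qed.

Lemma ler_enormB x y : enorm x - enorm y <= enorm (x - y).
Proof. by rewrite lerBlDr -{1}[x](subrK y) ler_enormD. Qed.

Lemma ler_dist_enorm x y : `|enorm x - enorm y| <= enorm (x - y).
Proof. by rewrite ler_norml ler_enormB andbT lerNl opprB enorm_distC ler_enormB. Qed.

Lemma coord_le_enorm x i : `|x ord0 i| <= enorm x.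
Proof.
rewrite -sqrtr_sqr ler_sqrt ?sumr_ge0// => [|j _]; last exact: sqr_ge0.
by rewrite (bigD1 i)//= lerDl sumr_ge0// => j _; rewrite sqr_ge0.
Qed.

Lemma enorm_le_coord x a : 0 <= a -> (forall i, `|x ord0 i| <= a) ->
  enorm x <= n%:R * a.
Proof.
move=> a0 xa; rewrite -(@ler_pXn2r _ 2)// ?nnegrE ?mulr_ge0 ?enorm_ge0//.
rewrite sqr_enorm exprMn; apply: (@le_trans _ _ (\sum_(i < n) a ^+ 2)).
  by apply: ler_sum => i _; rewrite -real_normK ?num_real// lerXn2r// nnegrE.
rewrite sumr_const card_ord -[leLHS]mulr_natl ler_wpM2r ?sqr_ge0//.
rewrite -natrX ler_nat; case: (n) => // k; by rewrite expnS leq_pmulr.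
Qed.

Lemma measurable_eclosed_ball x r : measurable (eclosed_ball x r).
Proof.
rewrite (_ : eclosed_ball x r = (fun y => enorm (y - x)) @^-1` `]-oo, r]).
  rewrite -[X in measurable X]setTI.
  suff : measurable_fun setT (fun y : 'rV[R]_n => enorm (y - x)).
    by apply.
  apply: (@measurableT_comp _ _ _ _ _ _ (@enorm R n) _ (fun y => y - x)).
    exact: measurable_enorm.
  apply: measurable_fun_rV => i; under eq_fun do rewrite mxE.
  apply: measurable_funD; first exact: measurable_coord.
  by under eq_fun do rewrite mxE; exact: measurable_cst.
by apply/seteqP; split => y /=; rewrite in_itv.
Qed.

Lemma measurable_esphere : measurable (esphere R n).
Proof.
rewrite (_ : esphere R n = @enorm R n @^-1` [set 1]) //.
rewrite -[X in measurable X]setTI; exact: measurable_enorm.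
Qed.

End euclidean_norm.

Definition cube (R : realType) n (c : 'rV[R]_n) (a : R) : set 'rV[R]_n :=
  [set y | forall i, `|y ord0 i - c ord0 i| <= a].

Section cubes.
Context (R : realType).

Lemma measurable_cube n (c : 'rV[R]_n) (a : R) : measurable (cube c a).
Proof.
rewrite (_ : cube c a = \big[setI/setT]_(i < n)
   ((fun y : 'rV[R]_n => y ord0 i) @^-1` [set t | `|t - c ord0 i| <= a])).
  apply: bigsetI_measurable => i _; rewrite -[X in measurable X]setTI.
  apply: measurable_coord => //.
  rewrite (_ : [set t | _] = `[c ord0 i - a, c ord0 i + a]%classic).
    exact: measurable_itv.
  by apply/seteqP; split => t /=; rewrite in_itv/= ler_distl.
rewrite -bigcap_seq; apply/seteqP; split => y /= h i; first by move=> _; exact: h.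
by apply: h; rewrite /= mem_index_enum.
Qed.

Lemma rV_lebesgue_cube n (c : 'rV[R]_n) (a : R) : 0 <= a ->
  rV_lebesgue (cube c a) = ((2 * a) ^+ n)%:E.
Proof.
move=> a0; elim: n c => [c|n IH c].
  rewrite /= diracE expr0 mem_set//= => i; by case: i.
rewrite /= /pushforward.
pose c' : 'rV[R]_n := \row_i c ord0 (lift ord0 i).
rewrite (_ : _ @^-1` _ =
    `[c ord0 ord0 - a, c ord0 ord0 + a]%classic `*` cube c' a); last first.
  apply/seteqP; split => -[t y] /=.
    move=> h; split.
      by have := h ord0; rewrite consrow0/= in_itv/= ler_distl.
    by move=> i; have := h (lift ord0 i); rewrite consrowS/= mxE.
  rewrite in_itv/= -ler_distl => -[h0 h] i; case: (unliftP ord0 i) => [j|] ->.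
    by rewrite consrowS/=; have := h j; rewrite mxE.
  by rewrite consrow0.
rewrite product_measure1E//; last exact: measurable_cube.
transitivity (@lebesgue_measure R `[(c ord0 ord0 - a)%R, (c ord0 ord0 + a)%R]%classic
  * rV_lebesgue (cube c' a))%E => //.
rewrite IH lebesgue_measure_itv/= lte_fin.
case: ltP => [_|h].
  rewrite -EFinD -EFinM exprS; congr (_%:E); congr (_ * _); ring.
have -> : a = 0 by apply/eqP; rewrite eq_le a0 andbT; lra.
by rewrite mul0e mulr0 expr0n.
Qed.

End cubes.

(** * Measure of spherical caps *)

Lemma sum_measure_le d (T : measurableType d) (R : realType)
    (mu : {measure set T -> \bar R}) (I : choiceType) (s : seq I)
    (F : I -> set T) (A : set T) :
  uniq s -> (forall i, i \in s -> measurable (F i)) -> measurable A ->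
  trivIset [set` s] F -> (forall i, i \in s -> F i `<=` A) ->
  (\sum_(i <- s) mu (F i) <= mu A)%E.
Proof.
move=> us mF mA tF FA.
rewrite fsbig_seq// -measure_fsbig// -fsbig_seq// -bigcup_seq.
apply: le_measure; rewrite ?inE//; last by apply: bigcup_sub => i; exact: FA.
by apply: fin_bigcup_measurable => // i; exact: mF.
Qed.

Section caps.
Context (R : realType) (d : nat).
Local Notation S := (esphere R d.+1).
Local Notation V := (@rV_lebesgue R d.+1).
Local Notation sigma := (sphere_measure R d.+1).
Implicit Types (x y : 'rV[R]_d.+1) (r : R).

Definition ball_vol : R := fine (V (eclosed_ball 0 1)).

Lemma unit_ball_sub_cube : eclosed_ball (0 : 'rV[R]_d.+1) 1 `<=` cube 0 1.
Proof.
move=> y /=; rewrite /eclosed_ball/= subr0 => y1 i; rewrite mxE subr0.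
exact: le_trans (coord_le_enorm _ _) _.
Qed.

Lemma unit_ball_fin_num : V (eclosed_ball 0 1) \is a fin_num.
Proof.
rewrite ge0_fin_numE//; apply: le_lt_trans.
  apply: le_measure unit_ball_sub_cube; rewrite inE.
    exact: measurable_eclosed_ball.
  exact: measurable_cube.
by rewrite [ltLHS]rV_lebesgue_cube// ltry.
Qed.

Lemma ball_vol_gt0 : 0 < ball_vol.
Proof.
rewrite -lte_fin fineK ?unit_ball_fin_num//.
have h : cube (0 : 'rV[R]_d.+1) (d.+1%:R^-1) `<=` eclosed_ball 0 1.
  move=> y yc; rewrite /eclosed_ball/= subr0.
  rewrite (le_trans (enorm_le_coord (_ : 0 <= d.+1%:R^-1) _))//.
    by move=> i; have := yc i; rewrite mxE subr0.
  by rewrite mulfV.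
apply: (@lt_le_trans _ _ (V (cube 0 (d.+1%:R^-1)))).
  by rewrite rV_lebesgue_cube// lte_fin exprn_gt0// mulr_gt0.
apply: le_measure h; rewrite inE.
  exact: measurable_cube.
exact: measurable_eclosed_ball.
Qed.

Lemma sphere_measureE A : sigma A = (ball_vol^-1%:E * V (econe A))%E.
Proof. by []. Qed.

Lemma le_sphere_measure A (a : R) : (V (econe A) <= a%:E)%E ->
  (sigma A <= (ball_vol^-1 * a)%:E)%E.
Proof.
move=> h; rewrite sphere_measureE EFinM lee_pmul2l ?lte_fin//.
by rewrite invr_gt0 ball_vol_gt0.
Qed.

Lemma ge_sphere_measure A (a : R) : (a%:E <= V (econe A))%E ->
  ((ball_vol^-1 * a)%:E <= sigma A)%E.
Proof.
move=> h; rewrite sphere_measureE EFinM lee_pmul2l ?lte_fin//.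
by rewrite invr_gt0 ball_vol_gt0.
Qed.

Lemma econe_dist x r y : econe (eclosed_ball x r) y ->
  enorm (y - enorm y *: x) <= enorm y * r.
Proof.
move=> [/andP[y0 y1]]; rewrite /eclosed_ball/= => h.
have -> : y - enorm y *: x = enorm y *: ((enorm y)^-1 *: y - x).
  by rewrite scalerBr scalerA mulfV ?gt_eqF// scale1r.
by rewrite enormZ (gtr0_norm y0) ler_pM2l.
Qed.

(** The cone follows the segment from 0 to [x], so about [1/r] cubes of side [4 r] centred at the
    points [k r x] cover it. The number [N] of cubes satisfies [N r <= 2]. *)
Lemma cap_ub_small x r : S x -> 0 < r <= 1 ->
  (V (econe (eclosed_ball x r)) <= (2 * 4 ^+ d.+1 * r ^+ d)%:E)%E.
Proof.
move=> Sx /andP[r0 r1]; set N := (Num.truncn r^-1).+1.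
pose Q k := cube ((k%:R * r) *: x) (2 * r).
have sub : econe (eclosed_ball x r) `<=` \big[setU/set0]_(k < N) Q k.
  move=> y yc; have [/andP[y0 y1] _] := yc.
  have yd := econe_dist yc.
  pose k := Num.truncn (enorm y / r).
  have /andP[k1 k2] : k%:R <= enorm y / r < k.+1%:R.
    by apply: truncn_itv; rewrite divr_ge0 ?enorm_ge0 ?ltW.
  have kN : (k < N)%N.
    by rewrite ltnS le_truncn// ler_piMl// invr_ge0 ltW.
  rewrite -bigcup_mkord; exists k => //= i.
  have -> : y ord0 i - ((k%:R * r) *: x) ord0 i = (y - (k%:R * r) *: x) ord0 i.
    by rewrite !mxE.
  apply: le_trans (coord_le_enorm _ _) _.
  apply: le_trans (ler_enorm_dist (enorm y *: x) _ _) _.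
  rewrite -scalerBl enormZ Sx mulr1 mulr2n mulrDl mul1r lerD//.
    by apply: le_trans yd _; rewrite ler_piMl// ltW.
  move: k1 k2; rewrite ler_pdivlMr// ltr_pdivrMr// => k1 k2.
  rewrite ger0_norm ?subr_ge0// lerBlDl.
  by rewrite -nat1r mulrDl mul1r addrC in k2; exact: ltW.
apply: le_trans (@content_subadditive _ _ _ V _ _ _ _ _ sub) _.
- by move=> k _; exact: measurable_cube.
- by apply: measurable_econe; exact: measurable_eclosed_ball.
rewrite (eq_bigr (fun _ => ((2 * (2 * r)) ^+ d.+1)%:E)); last first.
  by move=> k _; rewrite [LHS]rV_lebesgue_cube// mulr_ge0// ltW.
rewrite sumEFin sumr_const card_ord lee_fin -[leLHS]mulr_natl.
have -> : (2 * (2 * r)) ^+ d.+1 = 4 ^+ d.+1 * r ^+ d * r.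
  have -> : 2 * (2 * r) = 4 * r by ring.
  by rewrite exprMn [r ^+ _.+1]exprSr mulrA.
have N2 : N%:R * r <= 2.
  have /andP[h _] : (Num.truncn r^-1)%:R <= r^-1 < N%:R.
    by apply: truncn_itv; rewrite invr_ge0 ltW.
  move: h; rewrite -(ler_pM2r r0) mulVf ?gt_eqF// => h.
  by rewrite /N -natr1 mulrDl mul1r; lra.
have : 0 <= 4 ^+ d.+1 * r ^+ d by rewrite mulr_ge0 ?exprn_ge0// ltW.
rewrite -[2 * _ * _]mulrA; set b := 4 ^+ d.+1 * r ^+ d.
by move=> b0; rewrite mulrCA mulrC ler_wpM2r.
Qed.

Lemma econe_sub_ball A : econe A `<=` eclosed_ball (0 : 'rV[R]_d.+1) 1.
Proof. by move=> y [/andP[_ y1] _]; rewrite /eclosed_ball/= subr0. Qed.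

Lemma cap_ub : exists2 C : R, 0 < C & forall x r, S x -> 0 < r ->
  (sigma (eclosed_ball x r) <= (C * r ^+ d)%:E)%E.
Proof.
exists (ball_vol^-1 * (2 * 4 ^+ d.+1)).
  by rewrite !mulr_gt0// ?invr_gt0 ?ball_vol_gt0// exprn_gt0.
move=> x r Sx r0; rewrite -mulrA; apply: le_sphere_measure.
have [r1|/ltW r1] := leP r 1; first by apply: cap_ub_small; rewrite ?r0.
apply: (@le_trans _ _ (V (cube 0 1))).
  apply: le_measure; rewrite ?inE.
  - by apply: measurable_econe; exact: measurable_eclosed_ball.
  - exact: measurable_cube.
  - exact: subset_trans (@econe_sub_ball _) unit_ball_sub_cube.
rewrite rV_lebesgue_cube// lee_fin mulr1.
have h1 : (2 : R) ^+ d.+1 <= 4 ^+ d.+1 by rewrite lerXn2r ?nnegrE// ler_nat.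
have h2 : 1 <= r ^+ d by rewrite exprn_ege1.
have : (0 : R) <= 2 ^+ d.+1 by rewrite exprn_ge0.
by move: h1 h2; set a := 2 ^+ _; set b := 4 ^+ _; nra.
Qed.

(** A point [y] within [e] of [t x] satisfies [|y - |y| x| <= 2 e], and [|y| >= 1/2], so its
    direction is within [4 e <= r] of [x]. The upper bound on [t] keeps [y] in the unit ball. *)
Lemma cap_lb_cube x r (t e : R) : S x -> 0 < r <= 1 -> e = r / 8 ->
  2^-1 + e <= t <= 1 - e ->
  cube (t *: x) (e / d.+1%:R) `<=` econe (eclosed_ball x r).
Proof.
move=> Sx /andP[r0 r1] eE /andP[t1 t2] y yc.
have e0 : 0 < e by rewrite eE divr_gt0.
have ye : enorm (y - t *: x) <= e.
  have -> : e = d.+1%:R * (e / d.+1%:R) by rewrite mulrC divfK.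
  apply: enorm_le_coord => [|i]; first by rewrite divr_ge0// ltW.
  by have := yc i; rewrite !mxE.
have t0 : 0 < t by lra.
have yt : `|enorm y - t| <= e.
  apply: le_trans ye; apply: le_trans (ler_dist_enorm _ _).
  by rewrite enormZ Sx mulr1 (gtr0_norm t0).
move: (yt); rewrite ler_distl => /andP[y1 y2].
have y0 : 0 < enorm y by lra.
split; first by rewrite y0; lra.
rewrite /eclosed_ball/=.
have -> : (enorm y)^-1 *: y - x = (enorm y)^-1 *: (y - enorm y *: x).
  by rewrite scalerBr scalerA mulVf ?gt_eqF// scale1r.
rewrite enormZ gtr0_norm ?invr_gt0// mulrC ler_pdivrMr//.
apply: le_trans (ler_enorm_dist (t *: x) _ _) _.
rewrite -scalerBl enormZ Sx mulr1 distrC.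
have : 2^-1 <= enorm y by lra.
by rewrite eE in ye yt *; nra.
Qed.

Lemma cap_lb : exists2 c : R, 0 < c & forall x r, S x -> 0 < r <= 1 ->
  ((c * r ^+ d)%:E <= sigma (eclosed_ball x r))%E.
Proof.
exists (ball_vol^-1 * ((4 * d.+1%:R)^-1 ^+ d.+1 * (2 / 3))).
  by rewrite !mulr_gt0// ?invr_gt0 ?ball_vol_gt0// exprn_gt0// invr_gt0 mulr_gt0.
move=> x r Sx r01; have /andP[r0 r1] := r01.
rewrite -mulrA; apply: ge_sphere_measure.
pose e := r / 8; pose K := Num.truncn (6 * e)^-1.
have e0 : 0 < e by rewrite divr_gt0.
have e1 : e <= 8^-1 by rewrite /e; lra.
have /andP[K1 K2] : K%:R <= (6 * e)^-1 < K.+1%:R.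
  by apply: truncn_itv; rewrite invr_ge0 mulr_ge0// ltW.
(* A real number that is at least 1 is at most twice its integer part. *)
have K3 : (12 * e)^-1 <= K%:R.
  have -> : (12 * e)^-1 = (6 * e)^-1 - (12 * e)^-1 by field; rewrite gt_eqF.
  have : 1 <= (12 * e)^-1 * 2 by rewrite mulrC ler_pdivlMr ?mul1r; lra.
  have -> : (12 * e)^-1 * 2 = (6 * e)^-1 by field; rewrite gt_eqF.
  have -> : (12 * e)^-1 = (6 * e)^-1 / 2 by field; rewrite gt_eqF.
  move: K1 K2; rewrite -[K.+1%:R]natr1; case: (K) => [|k]; first lra.
  rewrite -[k.+1%:R]natr1 => K1 K2 K3; have : 0 <= k%:R :> R by [].
  lra.
(* The spacing [3 e] exceeds [e + e], so the cubes are disjoint, and [K] of them fit along the outer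
   half of the radius because [6 e K <= 1]. *)
pose t (k : nat) : R := 2^-1 + e + 3 * e * k%:R.
pose Q k := cube (t k *: x) (e / d.+1%:R).
have tle (k : nat) : (k < K)%N -> t k <= 1 - e.
  move=> kK; move: K1; rewrite -div1r ler_pdivlMr ?mulr_gt0// => K1.
  have : (k%:R + 1) * (6 * e) <= K%:R * (6 * e).
    by rewrite ler_pM2r ?mulr_gt0// natr1 ler_nat.
  by rewrite /t; lra.
have QE k : V (Q k) = ((2 * (e / d.+1%:R)) ^+ d.+1)%:E.
  by rewrite rV_lebesgue_cube// divr_ge0// ltW.
apply: le_trans (sum_measure_le V (s := iota 0 K) (F := Q) _ _ _ _ _).
- rewrite (eq_bigr _ (fun k _ => QE k)) sumEFin big_const_seq count_predT size_iota.
  rewrite iter_addr_0 -[X in (_ <= X%:E)%E]mulr_natl lee_fin.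
  apply: le_trans (ler_wpM2r _ K3); last first.
    by rewrite exprn_ge0// mulr_ge0// divr_ge0// ltW.
  rewrite le_eqVlt; apply/orP; left; apply/eqP.
  have -> : 2 * (e / d.+1%:R) = (4 * d.+1%:R)^-1 * r.
    by rewrite /e; field.
  rewrite exprMn [in RHS]exprSr [r ^+ d.+1]exprSr; rewrite /e.
  set a := _ ^-1 ^+ d; set b := r ^+ d; rewrite exprSr -/a; field.
  apply/andP; split; last by rewrite gt_eqF.
  by rewrite gt_eqF//; have : 0 <= d%:R :> R by []; lra.
- exact: iota_uniq.
- by move=> k _; exact: measurable_cube.
- by apply: measurable_econe; exact: measurable_eclosed_ball.
- apply/trivIsetP => i j _ _ ij; apply/seteqP; split => // y [yi yj].
  have h k : Q k y -> enorm (y - t k *: x) <= e.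
    move=> yk; have -> : e = d.+1%:R * (e / d.+1%:R) by rewrite mulrC divfK.
    apply: enorm_le_coord => [|l]; first by rewrite divr_ge0// ltW.
    by have := yk l; rewrite !mxE.
  have : enorm (t i *: x - t j *: x) <= e + e.
    apply: le_trans (ler_enorm_dist y _ _) _; rewrite lerD// ?h//.
    by rewrite enorm_distC h.
  rewrite -scalerBl enormZ Sx mulr1 /t opprD addrACA subrr add0r -mulrBr.
  rewrite normrM gtr0_norm ?mulr_gt0//.
  have : 1 <= `|i%:R - j%:R| :> R.
    wlog lt_ij : i j ij {yi yj} / (i < j)%N.
      move=> W; have [/W|/W|] := ltngtP i j; rewrite ?(eq_sym j) ?ij//.
      + exact.
      + by rewrite distrC; exact.
      + by move/eqP; rewrite (negbTE ij).
    rewrite distrC ger0_norm ?subr_ge0 ?ler_nat// 1?ltnW// lerBrDl natr1.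
    by rewrite ler_nat.
  nra.
- move=> k; rewrite mem_iota add0n => /= kK; apply: cap_lb_cube => //.
  rewrite tle// andbT /t lerDl mulr_ge0// mulr_ge0// ltW//.
Qed.

End caps.

(** * The Poisson kernel and packings *)

Section poisson_kernel_bounds.
Context (R : realType) (d : nat).
Local Notation S := (esphere R d.+1).
Local Notation sigma := (sphere_measure R d.+1).
Implicit Types (x y xi : 'rV[R]_d.+1) (r : R).

Lemma enorm_esphere_dist x xi : S x -> S xi -> enorm (x - xi) <= 2.
Proof.
move=> Sx Sxi; apply: le_trans (ler_enormD _ _) _.
by rewrite enormN Sx Sxi; lra.
Qed.

Lemma radial_dist x xi r : S x -> 0 <= r -> enorm ((1 - r) *: x - xi) <= r + enorm (x - xi).
Proof.
move=> Sx r0; have -> : (1 - r) *: x - xi = - r *: x + (x - xi).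
  by apply/rowP => i; rewrite !mxE; ring.
by apply: le_trans (ler_enormD _ _) _; rewrite enormZ Sx mulr1 normrN ger0_norm.
Qed.

(** The point [(1 - r) x] has norm [1 - r], hence is at distance at least [r] from the sphere. With
    [radial_dist] this makes the kernel comparable to [r / (r + |x - xi|)^(d+1)]. *)
Lemma radial_dist_ge x xi r : S x -> S xi -> 0 < r <= 1 ->
  r + enorm (x - xi) <= 3 * enorm ((1 - r) *: x - xi).
Proof.
move=> Sx Sxi /andP[r0 r1].
have h1 : r <= enorm ((1 - r) *: x - xi).
  have := ler_enormB xi ((1 - r) *: x).
  rewrite Sxi enormZ Sx mulr1 ger0_norm ?subr_ge0// enorm_distC; lra.
have h2 : enorm (x - xi) <= r + enorm ((1 - r) *: x - xi).
  have -> : x - xi = r *: x + ((1 - r) *: x - xi).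
    by apply/rowP => i; rewrite !mxE; ring.
  by apply: le_trans (ler_enormD _ _) _; rewrite enormZ Sx mulr1 gtr0_norm.
lra.
Qed.

Lemma poisson_kernel_num x r : S x -> 0 <= r <= 1 ->
  1 - enorm ((1 - r) *: x) ^+ 2 = r * (2 - r).
Proof.
by move=> Sx /andP[r0 r1]; rewrite enormZ Sx mulr1 ger0_norm ?subr_ge0//; ring.
Qed.

Lemma poisson_kernel_ge x xi r : S x -> S xi -> 0 < r <= 1 ->
  r / (r + enorm (x - xi)) ^+ d.+1 <= poisson_kernel ((1 - r) *: x) xi.
Proof.
move=> Sx Sxi r01; have /andP[r0 r1] := r01.
rewrite /poisson_kernel poisson_kernel_num ?r1 ?(ltW r0)//.
have D0 : 0 < enorm ((1 - r) *: x - xi).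
  by have := radial_dist_ge Sx Sxi r01; have := enorm_ge0 (x - xi); lra.
have := radial_dist xi Sx (ltW r0); set D := enorm _ in D0 *; set E := r + _ => DE.
have E0 : 0 < E by exact: lt_le_trans DE.
apply: ler_pM; rewrite ?invr_ge0 ?exprn_ge0 ?(ltW r0) ?(ltW E0)//.
  by rewrite ler_peMr ?(ltW r0)//; lra.
by rewrite lef_pV2 ?posrE ?exprn_gt0// lerXn2r ?nnegrE// ltW.
Qed.

Lemma poisson_kernel_le x xi r : S x -> S xi -> 0 < r <= 1 ->
  poisson_kernel ((1 - r) *: x) xi <=
  2 * 3 ^+ d.+1 * (r / (r + enorm (x - xi)) ^+ d.+1).
Proof.
move=> Sx Sxi r01; have /andP[r0 r1] := r01.
rewrite /poisson_kernel poisson_kernel_num ?r1 ?(ltW r0)//.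
have E0 : 0 < r + enorm (x - xi) by have := enorm_ge0 (x - xi); lra.
have := radial_dist_ge Sx Sxi r01; set D := enorm ((1 - r) *: x - xi).
set E := r + _ in E0 * => ED.
have D0 : 0 < D by lra.
rewrite mulrACA; apply: ler_pM; rewrite ?invr_ge0 ?exprn_ge0 ?(ltW D0)//.
- by rewrite mulr_ge0 ?(ltW r0)//; lra.
- by rewrite mulrC ler_pM2r//; lra.
rewrite ler_pdivlMr ?exprn_gt0// mulrC ler_pdivrMr ?exprn_gt0//.
by rewrite -exprMn lerXn2r ?nnegrE ?mulr_ge0// ltW.
Qed.

Lemma poisson_kernel_ge0 x xi r : S x -> 0 < r <= 1 ->
  0 <= poisson_kernel ((1 - r) *: x) xi.
Proof.
move=> Sx /andP[r0 r1]; rewrite /poisson_kernel poisson_kernel_num ?r1 ?(ltW r0)//.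
by rewrite divr_ge0 ?exprn_ge0 ?enorm_ge0// mulr_ge0 ?(ltW r0)//; lra.
Qed.

Lemma poisson_kernel_le_cst x xi r : S x -> S xi -> 0 < r <= 1 ->
  poisson_kernel ((1 - r) *: x) xi <= 2 * 3 ^+ d.+1 * (r / r ^+ d.+1).
Proof.
move=> Sx Sxi r01; have /andP[r0 r1] := r01.
apply: le_trans (poisson_kernel_le Sx Sxi r01) _.
rewrite ler_pM2l ?mulr_gt0 ?exprn_gt0// ler_pM2l// lef_pV2 ?posrE ?exprn_gt0//.
  by rewrite lerXn2r ?nnegrE ?lerDl ?addr_ge0 ?enorm_ge0 ?ltW.
by rewrite ltr_pwDl ?enorm_ge0.
Qed.

Lemma measurable_enorm_dist x : measurable_fun [set: 'rV[R]_d.+1] (fun y => enorm (x - y)).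
Proof.
apply: (@measurableT_comp _ _ _ _ _ _ (@enorm R d.+1) _ (fun y => x - y)).
  exact: measurable_enorm.
apply: measurable_fun_rV => i; under eq_fun do rewrite mxE.
apply: measurable_funD; first exact: measurable_cst.
under eq_fun do rewrite mxE; apply: measurable_funN; exact: measurable_coord.
Qed.

Lemma measurable_poisson_kernel x :
  measurable_fun [set: 'rV[R]_d.+1] (poisson_kernel x).
Proof.
apply: measurable_funM; first exact: measurable_cst.
under eq_fun do rewrite -powR_inv1 ?exprn_ge0 ?enorm_ge0//.
apply: (@measurableT_comp _ _ _ _ _ _ (@powR R ^~ (-1))).
  exact: measurable_powR.
apply: measurable_funX; exact: measurable_enorm_dist.
Qed.

Lemma measurable_fun_L1 (f : 'rV[R]_d.+1 -> R) : L1_sphere f -> measurable_fun S f.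
Proof. by move=> /integrableP[/measurable_EFinP]. Qed.

Lemma measurable_poisson_mul (f : 'rV[R]_d.+1 -> R) x : measurable_fun S f ->
  measurable_fun S (fun xi => poisson_kernel x xi * f xi).
Proof.
move=> mf; apply: measurable_funM => //.
apply: measurable_funTS; exact: measurable_poisson_kernel.
Qed.

Lemma abs_poisson_integral_le (f : 'rV[R]_d.+1 -> R) x r : L1_sphere f ->
  S x -> 0 < r <= 1 ->
  (`|poisson_integral f ((1 - r) *: x)|%:E <=
   \int[sigma]_(xi in S) (poisson_kernel ((1 - r) *: x) xi * `|f xi|)%:E)%E.
Proof.
move=> L1f Sx r01; rewrite /poisson_integral /Rintegral.
have mS := @measurable_esphere R d.+1.
set I := (\int[_]_(_ in _) _)%E.
(* [fine] sends infinite values to 0, so the inequality needs no finiteness of [I]. *)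
have h : (`|fine I|%:E <= `|I|)%E by case: I => //= [|]; rewrite normr0 leey.
apply: le_trans h _.
apply: le_trans (le_abse_integral _ mS _) _.
  apply/measurable_EFinP; apply: measurable_poisson_mul.
  exact: measurable_fun_L1.
rewrite le_eqVlt; apply/orP; left; apply/eqP.
apply: eq_integral => xi _; rewrite abse_EFin normrM ger0_norm//.
exact: poisson_kernel_ge0.
Qed.

End poisson_kernel_bounds.

Lemma expr2_bracket (R : realType) (t : R) : 0 < t <= 1 ->
  exists j, 2^-1 ^+ j.+1 < t <= 2^-1 ^+ j.
Proof.
move=> /andP[t0 t1].
have ex : exists n, 2^-1 ^+ n < t.
  exists (Num.truncn t^-1).+1; rewrite exprVn invf_plt ?posrE ?exprn_gt0//.
  have /andP[_ h] : (Num.truncn t^-1)%:R <= t^-1 < (Num.truncn t^-1).+1%:R.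
    by apply: truncn_itv; rewrite invr_ge0 ltW.
  apply: lt_le_trans h _; rewrite -natrX ler_nat.
  by apply: ltnW; rewrite ltn_expl.
case: (ex_minnP ex) => -[|j] hj hmin; first by rewrite expr0 ltNge t1 in hj.
exists j; rewrite hj leNgt; apply/negP => /hmin; by rewrite ltnn.
Qed.

Lemma sum_geometric_le (R : realType) (q : R) M : 0 <= q < 1 ->
  \sum_(j < M) q ^+ j <= (1 - q)^-1.
Proof.
move=> /andP[q0 q1]; rewrite -div1r ler_pdivlMr ?subr_gt0//.
have -> : (\sum_(j < M) q ^+ j) * (1 - q) = 1 - q ^+ M.
  elim: M => [|M IH]; first by rewrite big_ord0 expr0; ring.
  by rewrite big_ord_recr/= mulrDl IH exprS; ring.
by rewrite gerBl exprn_ge0.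
Qed.

Section packings.
Context (R : realType) (d : nat).
Local Notation S := (esphere R d.+1).
Local Notation sigma := (sphere_measure R d.+1).

Definition ball_packing (s : seq nat) (x : nat -> 'rV[R]_d.+1) (r : nat -> R) :=
  [/\ uniq s, forall i, i \in s -> S (x i) /\ 0 < r i <= 1 &
      trivIset [set` s] (fun i => eclosed_ball (x i) (r i))].

Lemma sub_ball_packing s x r (p : pred nat) :
  ball_packing s x r -> ball_packing [seq i <- s | p i] x r.
Proof.
move=> [us sxr ts]; split; first exact: filter_uniq.
  by move=> i; rewrite mem_filter => /andP[_ /sxr].
apply: sub_trivIset ts => i /=; by rewrite mem_filter => /andP[].
Qed.

(** The disjoint balls all lie in the ball of radius [rho] about [xi], and a cap of radius [r] has
    measure comparable to [r^d]. *)
Lemma packing_sum_le : exists2 C : R, 0 < C & forall s x r xi (rho : R),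
  ball_packing s x r -> S xi -> 0 < rho ->
  (forall i, i \in s -> r i + enorm (x i - xi) <= rho) ->
  \sum_(i <- s) r i ^+ d <= C * rho ^+ d.
Proof.
have [C C0 hC] := cap_ub R d; have [c c0 hc] := cap_lb R d.
exists (C / c) => [|s x r xi rho [us sxr ts] Sxi rho0 srho]; first by rewrite divr_gt0.
rewrite mulrAC ler_pdivlMr// mulrC -lee_fin.
apply: le_trans (hC xi rho Sxi rho0).
apply: le_trans (sum_measure_le sigma us _ _ ts _).
- rewrite mulr_sumr -sumEFin big_seq [leRHS]big_seq; apply: lee_sum => i si.
  by have [Sx r01] := sxr i si; exact: hc.
- by move=> i _; exact: measurable_eclosed_ball.
- exact: measurable_eclosed_ball.
- move=> i si y; rewrite /eclosed_ball/= => yx; apply: le_trans (srho i si).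
  exact: le_trans (ler_enorm_dist (x i) _ _) (lerD yx (lexx _)).
Qed.

Lemma packing_kernel_le (e : R) : 0 < e -> exists2 C : R, 0 < C &
  forall s x r xi, ball_packing s x r -> S xi ->
  \sum_(i <- s) r i `^ (d%:R + e) * poisson_kernel ((1 - r i) *: x i) xi <= C.
Proof.
move=> e0; have [C C0 hC] := packing_sum_le.
have q1 : 2^-1 `^ e < 1 :> R.
  have p1 : 1 `^ e = 1 :> R by rewrite powR1.
  rewrite -[ltRHS]p1; apply: gt0_ltr_powR => //; rewrite ?nnegrE//.
  by rewrite invf_lt1// ltr1n.
(* In order: the kernel bound, the lower end of a dyadic shell, [packing_sum_le], the normalization
   [rho i <= 3] (from [r i <= 1] and [|x i - xi| <= 2]), and the sum of the geometric series over
   the shells. *)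
exists (2 * 3 ^+ d.+1 * (2 ^+ d * C * 3 `^ e * (1 - 2^-1 `^ e)^-1)).
  by rewrite !mulr_gt0 ?exprn_gt0 ?powR_gt0 ?invr_gt0 ?subr_gt0.
move=> s x r xi pk Sxi; have [us sxr ts] := pk.
pose rho i := r i + enorm (x i - xi).
have rho03 i : i \in s -> 0 < rho i / 3 <= 1.
  move=> si; have [Sx /andP[r0 r1]] := sxr i si.
  have := enorm_esphere_dist Sx Sxi; have := enorm_ge0 (x i - xi).
  by rewrite /rho => h1 h2; apply/andP; split; lra.
have /choice[J hJ] : forall i, exists j, i \in s ->
    2^-1 ^+ j.+1 < rho i / 3 <= 2^-1 ^+ j.
  move=> i; have [si|_] := boolP (i \in s); last by exists 0%N.
  by have [j hj] := expr2_bracket (rho03 i si); exists j.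
pose M := (\max_(i <- s) J i).+1.
have JM i : i \in s -> (J i < M)%N by move=> si; rewrite ltnS leq_bigmax_seq.
pose a i := r i ^+ d * (rho i `^ e / rho i ^+ d).
apply: (@le_trans _ _ (\sum_(i <- s) 2 * 3 ^+ d.+1 * a i)).
  rewrite big_seq [leRHS]big_seq; apply: ler_sum => i si.
  have [Sx r01] := sxr i si; have /andP[r0 r1] := r01.
  have rr : r i <= rho i by rewrite lerDl enorm_ge0.
  have rho0 : 0 < rho i by exact: lt_le_trans rr.
  apply: le_trans (ler_wpM2l (powR_ge0 _ _) (poisson_kernel_le Sx Sxi r01)) _.
  rewrite mulrCA ler_pM2l ?mulr_gt0 ?exprn_gt0// -/(rho i) /a.
  rewrite powRD; last by rewrite (gt_eqF r0) implybT.
  rewrite powR_mulrn ?(ltW r0)// -[leLHS]mulrA ler_pM2l ?exprn_gt0//.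
  have -> : r i `^ e * (r i / rho i ^+ d.+1) = r i `^ e * (r i / rho i) / rho i ^+ d.
    by rewrite exprS invfM; ring.
  apply: ler_wpM2r; first by rewrite invr_ge0 exprn_ge0 ?ltW.
  rewrite -[leRHS]mulr1; apply: ler_pM; rewrite ?powR_ge0 ?divr_ge0 ?(ltW r0) ?(ltW rho0)//.
    by apply: ge0_ler_powR; rewrite ?nnegrE ?(ltW r0) ?(ltW rho0) ?(ltW e0).
  by rewrite ler_pdivrMr ?mul1r.
rewrite -mulr_sumr ler_pM2l ?mulr_gt0 ?exprn_gt0//.
rewrite big_seq (partition_big (fun i => inord (J i) : 'I_M) xpredT)//=.
apply: (@le_trans _ _ (\sum_(j < M) 2 ^+ d * C * 3 `^ e * (2^-1 `^ e) ^+ j)); last first.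
  rewrite -mulr_sumr ler_pM2l ?mulr_gt0 ?exprn_gt0 ?powR_gt0//.
  by apply: sum_geometric_le; rewrite powR_ge0.
apply: ler_sum => j _.
pose sj := [seq i <- s | J i == j].
have -> : \sum_(i <- s | (i \in s) && (inord (J i) == j)) a i = \sum_(i <- sj) a i.
  rewrite big_filter big_seq_cond [RHS]big_seq_cond; apply: eq_bigl => i.
  have [si|//] := boolP (i \in s); rewrite /=.
  by rewrite -val_eqE/= inordK// JM.
pose b : R := 3 * 2^-1 ^+ j.
have b0 : 0 < b by rewrite mulr_gt0 ?exprn_gt0.
(* On the shell [j], [rho i] lies between [b / 2] and [b], so the second factor becomes a constant
   and [packing_sum_le] with radius [b] handles the rest. *)
apply: (@le_trans _ _ (\sum_(i <- sj) r i ^+ d * (b `^ e / (b / 2) ^+ d))).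
  rewrite big_seq [leRHS]big_seq; apply: ler_sum => i.
  rewrite mem_filter => /andP[/eqP Jij si].
  have [Sx /andP[r0 r1]] := sxr i si.
  have /andP[h1 h2] := hJ i si; have /andP[h3 h4] := rho03 i si.
  have rho0 : 0 < rho i by lra.
  rewrite /a ler_pM2l ?exprn_gt0//.
  have bl : rho i <= b by rewrite /b -Jij -ler_pdivrMl// mulrC.
  have bu : b / 2 <= rho i.
    by move: h1; rewrite Jij exprSr ltr_pdivlMr// /b => /ltW; lra.
  apply: ler_pM; rewrite ?powR_ge0 ?invr_ge0 ?exprn_ge0 ?(ltW rho0)//.
    by apply: ge0_ler_powR; rewrite ?nnegrE ?(ltW b0) ?(ltW rho0) ?(ltW e0).
  rewrite lef_pV2 ?posrE ?exprn_gt0 ?divr_gt0// lerXn2r ?nnegrE ?(ltW rho0)//.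
  by rewrite divr_ge0 ?(ltW b0).
rewrite -mulr_suml.
have := hC sj x r xi b (sub_ball_packing (fun i => J i == j) pk) Sxi b0.
move=> /(_ _)/(ler_wpM2r _) h; apply: le_trans (h _ _ _) _.
- by rewrite divr_ge0 ?powR_ge0 ?exprn_ge0 ?divr_ge0 ?(ltW b0).
- move=> i; rewrite mem_filter => /andP[/eqP Jij si].
  by have /andP[_] := hJ i si; rewrite Jij ler_pdivrMr// mulrC.
rewrite le_eqVlt; apply/orP; left; apply/eqP.
have -> : b `^ e = 3 `^ e * (2^-1 `^ e) ^+ j.
  rewrite /b powRM ?exprn_ge0// -[2^-1 ^+ j]powR_mulrn// -powRrM [_ * e]mulrC powRrM.
  by rewrite powR_mulrn ?powR_ge0//.
rewrite expr_div_n; set B := b ^+ d; have B0 : 0 < B by rewrite exprn_gt0.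
set D := 2 ^+ d; have D0 : 0 < D by rewrite exprn_gt0.
by field; rewrite !lt0r_neq0.
Qed.

Lemma packing_poisson_le (e : R) : 0 < e -> exists2 C : R, 0 < C &
  forall f s x r, L1_sphere f -> ball_packing s x r ->
  (\sum_(i <- s) (r i `^ (d%:R + e) *
     `|poisson_integral f ((1 - r i) *: x i)|)%:E
   <= C%:E * \int[sigma]_(xi in S) `|f xi|%:E)%E.
Proof.
move=> e0; have [C C0 hC] := packing_kernel_le e0; exists C => // f s x r L1f pk.
have [us sxr ts] := pk.
have mS := @measurable_esphere R d.+1.
have mf := measurable_fun_L1 L1f.
have mnf : measurable_fun S (fun xi => `|f xi|) by exact: measurableT_comp.
have mPf y : measurable_fun S (fun xi => poisson_kernel y xi * `|f xi|).
  exact: measurable_poisson_mul.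
pose g i xi := r i `^ (d%:R + e) * (poisson_kernel ((1 - r i) *: x i) xi * `|f xi|).
have mg i : measurable_fun S (g i) by apply: measurable_funM => //; exact: measurable_cst.
have g0 i xi : i \in s -> 0 <= g i xi.
  move=> /sxr[Sx r01]; apply: mulr_ge0; first exact: powR_ge0.
  by apply: mulr_ge0 => //; exact: poisson_kernel_ge0.
(* [g i] is known to be nonnegative only for [i] in [s]. The maximum with 0 is nonnegative for every
   index, as the exchange of sum and integral requires. *)
apply: (@le_trans _ _ (\sum_(i <- s) \int[sigma]_(xi in S) (Num.max (g i xi) 0)%:E)%E).
  rewrite big_seq [leRHS]big_seq; apply: lee_sum => i si.
  have [Sx r01] := sxr i si.
  under eq_integral do rewrite max_l ?g0// EFinM.
  rewrite ge0_integralZl//.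
  - rewrite EFinM lee_pmul2l ?lte_fin ?powR_gt0//; last by case/andP: r01.
    exact: abs_poisson_integral_le.
  - exact/measurable_EFinP.
  - by move=> xi _; rewrite lee_fin mulr_ge0//; exact: poisson_kernel_ge0.
  - by rewrite lee_fin powR_ge0.
rewrite -ge0_integral_sum//=; last 2 first.
- by move=> i; apply/measurable_EFinP; apply: measurable_maxr => //; exact: measurable_cst.
- by move=> i xi _; rewrite lee_fin le_max lexx orbT.
rewrite -ge0_integralZl//; last 2 first.
- exact/measurable_EFinP.
- by rewrite lee_fin ltW.
apply: ge0_le_integral => //.
- by move=> xi _; rewrite sume_ge0// => i _; rewrite lee_fin le_max lexx orbT.
- apply: emeasurable_sum => i; apply/measurable_EFinP.
  by apply: measurable_maxr => //; exact: measurable_cst.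
- by apply/measurable_EFinP; apply: measurable_funM => //; exact: measurable_cst.
move=> xi Sxi; rewrite sumEFin -EFinM lee_fin.
apply: le_trans (ler_wpM2r (normr_ge0 (f xi)) (hC s x r xi pk Sxi)).
rewrite mulr_suml big_seq [leRHS]big_seq; apply: ler_sum => i si.
by rewrite max_l ?g0// /g mulrA.
Qed.

End packings.

(** * Packing dimension of the sets of large growth *)

Section liminf_limsup.
Context (R : realType).

Lemma near_left1P (P : R -> Prop) : (\forall r \near (1 : R)^'-, P r) <->
  exists2 e : R, 0 < e & forall t, 0 < t < e -> P (1 - t).
Proof.
rewrite nbhs_left0P; split.
  move=> /nbhs_ballP[e /= e0 he]; exists e => // t /andP[t0 te].
  have /he : ball (0 : R) e t by rewrite /ball/= sub0r normrN gtr0_norm.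
  exact.
move=> [e e0 he]; apply/nbhs_ballP; exists e => //= t.
rewrite /ball/= sub0r normrN => te t0; apply: he.
by rewrite t0/= -(gtr0_norm t0).
Qed.

Lemma limf_einf_geP (g : R -> \bar R) (b : R) :
  (b%:E <= limf_einf g 1^'-)%E <->
  forall b', b' < b -> exists2 e : R, 0 < e &
    forall t : R, 0 < t < e -> (b'%:E <= g (1 - t)%R)%E.
Proof.
rewrite limf_einfE; split.
  move=> h b' b'b; have : (b'%:E < ereal_sup [set ereal_inf [set g x | x in V] | V in 1^'-])%E.
    by apply: lt_le_trans h; rewrite lte_fin.
  move=> /ereal_sup_gt[_ [V /near_left1P[e e0 he] <-] hV].
  exists e => // t /he Vt; apply: (le_trans (ltW hV)).
  by apply: ereal_inf_lbound; exists (1 - t).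
move=> h; apply/lee_subgt0Pr => e e0.
have [|u u0 hu] := h (b - e); first by rewrite gtrBl.
apply: le_trans (ereal_sup_ubound _); last first.
  exists [set r | (b - e)%:E <= g r]%E => //.
  by apply/near_left1P; exists u.
by apply: le_ereal_inf_tmp => _ [r hr <-]; exact: hr.
Qed.

Lemma limf_esup_leP (g : R -> \bar R) (b : R) :
  (limf_esup g 1^'- <= b%:E)%E <->
  forall b', b < b' -> exists2 e : R, 0 < e &
    forall t : R, 0 < t < e -> (g (1 - t)%R <= b'%:E)%E.
Proof.
have -> : (limf_esup g 1^'- <= b%:E)%E = ((- b)%:E <= limf_einf (fun r => - g r) 1^'-)%E.
  by rewrite limf_einfN EFinN leeN2.
rewrite limf_einf_geP; split=> h b' bb'.
  have [|e e0 he] := h (- b'); first by rewrite ltrN2.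
  by exists e => // t /he; rewrite EFinN leeN2.
have [|e e0 he] := h (- b'); first by rewrite ltrNr.
by exists e => // t /he; rewrite EFinN leeNr.
Qed.

Lemma limf_einf_le_esup (g : R -> \bar R) :
  (limf_einf g 1^'- <= limf_esup g 1^'-)%E.
Proof.
rewrite limf_einfE; apply: ge_ereal_sup => _ [V hV <-].
apply: le_ereal_inf_tmp => _ [W hW <-].
have /filter_ex[r [Vr Wr]] : (\forall r \near (1 : R)^'-, V r /\ W r).
  by apply: filterI.
apply: (@le_trans _ _ (g r)).
  by apply: ereal_inf_lbound; exists r.
by apply: ereal_sup_ubound; exists r.
Qed.

End liminf_limsup.

(** * Growth exponents as power bounds on the Poisson integral *)

Section growth.
Context (R : realType) (d : nat).
Implicit Types (f : 'rV[R]_d.+1 -> R) (x : 'rV[R]_d.+1) (b t : R).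

Lemma growth_ratio_geP f x b t : 0 < t < 1 ->
  (b%:E <= growth_ratio f x (1 - t)%R)%E =
  (t `^ (- b) <= `|poisson_integral f ((1 - t) *: x)|).
Proof.
move=> /andP[t0 t1]; rewrite /growth_ratio subKr.
set p := `|_|; have p0 : 0 <= p by exact: normr_ge0.
have L0 : 0 < - ln t by rewrite oppr_gt0 ln_lt0 ?t0.
(* If the Poisson integral vanishes, the ratio is [-oo], and the right-hand side is false too since
   [t^(-b) > 0]. *)
move: p0; rewrite le_eqVlt => /predU1P[<-|p0].
  rewrite le0_lneNy// mulNyr gtr0_sg ?invr_gt0// mul1e leeNy_eq/=.
  by apply/esym/negbTE; rewrite -ltNge powR_gt0.
rewrite lne_EFin// -EFinM lee_fin ler_pdivlMr//.
by rewrite -[RHS]ler_ln ?posrE ?powR_gt0// ln_powR mulrN mulNr.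
Qed.

Lemma growth_ratio_leP f x b t : 0 < t < 1 ->
  (growth_ratio f x (1 - t)%R <= b%:E)%E =
  (`|poisson_integral f ((1 - t) *: x)| <= t `^ (- b)).
Proof.
move=> /andP[t0 t1]; rewrite /growth_ratio subKr.
set p := `|_|; have p0 : 0 <= p by exact: normr_ge0.
have L0 : 0 < - ln t by rewrite oppr_gt0 ln_lt0 ?t0.
move: p0; rewrite le_eqVlt => /predU1P[<-|p0].
  rewrite le0_lneNy// mulNyr gtr0_sg ?invr_gt0// mul1e leNye.
  by rewrite powR_ge0.
rewrite lne_EFin// -EFinM lee_fin ler_pdivrMr//.
by rewrite -[RHS]ler_ln ?posrE ?powR_gt0// ln_powR mulrN mulNr.
Qed.

Lemma beta_plus_geP f x b : (b%:E <= beta_plus f x)%E <->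
  forall b', b' < b -> exists2 e : R, 0 < e & forall t, 0 < t < e ->
    t `^ (- b') <= `|poisson_integral f ((1 - t) *: x)|.
Proof.
rewrite /beta_plus limf_einf_geP; split=> h b' /h[e e0 he];
  exists (Num.min e 1); rewrite ?lt_min ?e0//= => t;
  rewrite lt_min => /and3P[t0 te t1].
- by rewrite -growth_ratio_geP ?t0// he ?t0.
- by rewrite growth_ratio_geP ?t0// he ?t0.
Qed.

Lemma beta_minus_leP f x b : (beta_minus f x <= b%:E)%E <->
  forall b', b < b' -> exists2 e : R, 0 < e & forall t, 0 < t < e ->
    `|poisson_integral f ((1 - t) *: x)| <= t `^ (- b').
Proof.
rewrite /beta_minus limf_esup_leP; split=> h b' /h[e e0 he];
  exists (Num.min e 1); rewrite ?lt_min ?e0//= => t;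
  rewrite lt_min => /and3P[t0 te t1].
- by rewrite -growth_ratio_leP ?t0// he ?t0.
- by rewrite growth_ratio_leP ?t0// he ?t0.
Qed.

Lemma beta_plus_le_minus f x : (beta_plus f x <= beta_minus f x)%E.
Proof. exact: limf_einf_le_esup. Qed.

End growth.

Section packing_dimension_bound.
Context (R : realType) (d : nat).
Local Notation S := (esphere R d.+1).
Local Notation sigma := (sphere_measure R d.+1).
Implicit Types (f : 'rV[R]_d.+1 -> R) (E F : set 'rV[R]_d.+1).

Lemma packing_premeasure_at_ge0 n (s delta : R) (E : set 'rV[R]_n) :
  (0 <= packing_premeasure_at s delta E)%E.
Proof.
apply: ereal_sup_ubound; exists set0, (fun=> 0), (fun=> 0); split.
  by split => // i [].
by rewrite esum_set0.
Qed.

Lemma packing_premeasure_ge0 n (s : R) (E : set 'rV[R]_n) :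
  (0 <= packing_premeasure s E)%E.
Proof. by apply: le_ereal_inf_tmp => _ [delta _ <-]; exact: packing_premeasure_at_ge0. Qed.

Lemma packing_measure_ge0 n (s : R) (E : set 'rV[R]_n) :
  (0 <= packing_measure s E)%E.
Proof.
apply: le_ereal_inf_tmp => _ [F _ <-]; apply: nneseries_ge0 => i _ _.
exact: packing_premeasure_ge0.
Qed.

(** An [esum] is a supremum over finite subfamilies, so finite packings suffice. *)
Lemma packing_premeasure_at_le n (s delta : R) (E : set 'rV[R]_n) (M : \bar R) :
  (forall (l : seq nat) (x : nat -> 'rV[R]_n) r,
    uniq l -> (forall i, i \in l -> E (x i) /\ 0 < r i <= delta) ->
    trivIset [set` l] (fun i => eclosed_ball (x i) (r i)) ->
    (\sum_(i <- l) ((2 * r i) `^ s)%:E <= M)%E) ->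
  (packing_premeasure_at s delta E <= M)%E.
Proof.
move=> h; apply: ge_ereal_sup => _ [I [x [r [[Exr tI] ->]]]].
apply: ge_ereal_sup => _ [A [fA AI] <-].
rewrite fsbig_finite//=; apply: h.
- exact: finmap.fset_uniq.
- by move=> i; rewrite in_fset_set// inE => /AI; exact: Exr.
- by apply: sub_trivIset tI => i /=; rewrite in_fset_set// inE => /AI.
Qed.

(** With [e] half the gap, [s = e + (d + e) - b]. So [r^s = r^e r^(d+e) r^(-b)] is at most [delta^e
    r^(d+e) |P[f]((1-r)x)|], and [packing_poisson_le] bounds the sum by a constant times [delta^e],
    which tends to 0. *)
Lemma packing_premeasure_growth0 f F (b s e0 : R) : L1_sphere f -> F `<=` S ->
  0 < e0 -> d%:R - b < s ->
  (forall x, F x -> forall t, 0 < t < e0 ->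
    t `^ (- b) <= `|poisson_integral f ((1 - t) *: x)|) ->
  packing_premeasure s F = 0%E.
Proof.
move=> L1f FS e00 bs growth; apply/eqP; rewrite eq_le packing_premeasure_ge0 andbT.
pose e := (s - (d%:R - b)) / 2; have e_gt0 : 0 < e by rewrite divr_gt0 ?subr_gt0.
have [C C0 hC] := packing_poisson_le d e_gt0.
have mS := @measurable_esphere R d.+1.
have /integrableP[mf foo] := L1f.
set N := (\int[sigma]_(xi in S) `|f xi|%:E)%E.
have Nfin : N \is a fin_num.
  rewrite ge0_fin_numE//; exact: integral_ge0.
pose M := 2 `^ s * (C * fine N).
have M0 : 0 <= M.
  by rewrite !mulr_ge0 ?powR_ge0 ?(ltW C0)// fine_ge0// integral_ge0.
apply/lee_addgt0Pr => eta eta0; rewrite add0e.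
(* The last entry gives [delta^e M <= eta], with [M + 1] in place of [M] because [M] may be 0. The
   entry [e0 / 2] makes the radii strictly smaller than [e0]. *)
pose delta := Num.min (Num.min (e0 / 2) 1) ((eta / (M + 1)) `^ e^-1).
have delta0 : 0 < delta.
  by rewrite !lt_min ltr01 divr_gt0//= powR_gt0// divr_gt0// ltr_wpDl.
apply: (@le_trans _ _ (packing_premeasure_at s delta F)).
  by apply: ereal_inf_lbound; exists delta.
apply: (@packing_premeasure_at_le d.+1) => l x r ul lr tl.
have dle : forall i, i \in l -> [/\ 0 < r i, r i < e0, r i <= 1 & r i <= delta].
  move=> i /lr[_ /andP[ri0 rid]]; 
  have h1 : r i <= e0 / 2 by apply: le_trans rid _; rewrite /delta !ge_min lexx.
  have h2 : r i <= 1 by apply: le_trans rid _; rewrite /delta !ge_min lexx orbT.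
  have h3 : r i < e0 by apply: le_lt_trans h1 _; lra.
  by split.
have pk : ball_packing l x r.
  split => // i il; have [r0 _ r1 _] := dle i il; split; last by rewrite r0.
  by apply: FS; have [] := lr i il.
have key := hC f l x r L1f pk.
rewrite sumEFin; rewrite sumEFin -/N -(fineK Nfin) -EFinM lee_fin in key.
rewrite lee_fin; apply: (@le_trans _ _ (2 `^ s * (delta `^ e * (C * fine N)))).
  apply: (@le_trans _ _ (2 `^ s * (delta `^ e * \sum_(i <- l) r i `^ (d%:R + e) *
       `|poisson_integral f ((1 - r i) *: x i)|))); last first.
    rewrite ler_wpM2l ?powR_ge0// ler_wpM2l ?powR_ge0//.
  rewrite !mulr_sumr big_seq [leRHS]big_seq; apply: ler_sum => i il.
  have [r0 re r1 rd] := dle i il; have [Fx _] := lr i il.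
  rewrite powRM ?(ltW r0)// ler_wpM2l ?powR_ge0//.
  have -> : s = e + ((d%:R + e) - b) by rewrite /e; field.
  rewrite powRD; last by rewrite (gt_eqF r0) implybT.
  apply: ler_pM; rewrite ?powR_ge0//.
    by apply: ge0_ler_powR; rewrite ?nnegrE ?(ltW e_gt0) ?(ltW r0) ?(ltW delta0).
  rewrite powRD; last by rewrite (gt_eqF r0) implybT.
  by rewrite ler_wpM2l ?powR_ge0// growth// r0.
rewrite mulrCA -/M; apply: (@le_trans _ _ ((eta / (M + 1)) * M)).
  apply: ler_wpM2r => //.
  have -> : eta / (M + 1) = ((eta / (M + 1)) `^ e^-1) `^ e.
    by rewrite -powRrM mulVf ?gt_eqF// powRr1// divr_ge0 ?(ltW eta0)// addr_ge0.
  apply: ge0_ler_powR; rewrite ?nnegrE ?(ltW e_gt0) ?(ltW delta0) ?powR_ge0//.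
  by rewrite /delta ge_min lexx orbT.
rewrite mulrAC ler_pdivrMr ?ltr_wpDl// ler_wpM2l ?(ltW eta0)//.
by rewrite lerDl.
Qed.

Lemma packing_dim_le n (E : set 'rV[R]_n) (a : R) : 0 <= a ->
  (forall s, a < s -> packing_measure s E = 0%E) -> (packing_dim E <= a%:E)%E.
Proof.
move=> a0 h; apply/lee_addgt0Pr => e e0; apply: ereal_inf_lbound.
exists (a + e) => //; split; first by rewrite addr_ge0 ?(ltW e0).
by apply: h; rewrite ltrDl.
Qed.

Lemma packing_dim_level_set_plus_ge f (b : R) : L1_sphere f -> b <= d%:R ->
  (packing_dim (level_set_plus_ge b f) <= (d%:R - b)%:E)%E.
Proof.
move=> L1f bd; apply: packing_dim_le => [|s bs]; first by rewrite subr_ge0.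
apply/eqP; rewrite eq_le packing_measure_ge0 andbT.
(* The midpoint is below [b], so growth of order [b'] eventually holds, and above [d - s], so the
   premeasure of exponent [s] vanishes. *)
pose b' := (b + (d%:R - s)) / 2.
have b'b : b' < b by rewrite /b'; lra.
have b's : d%:R - b' < s by rewrite /b'; lra.
(* The scale below which the growth holds depends on the point. Sorting the points by this scale
   gives countably many sets with uniform growth, which is what the passage from premeasure to
   measure allows. *)
pose F (k : nat) := [set x | S x /\ forall t, 0 < t < k.+1%:R^-1 ->
    t `^ (- b') <= `|poisson_integral f ((1 - t) *: x)|].
apply: (@le_trans _ _ (\sum_(0 <= k <oo) packing_premeasure s (F k))%E).
  apply: ereal_inf_lbound; exists F => // x [Sx /beta_plus_geP/(_ b' b'b)[e e0 he]].
  exists (Num.truncn e^-1) => //; split => // t /andP[t0 tk].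
  apply: he; rewrite t0/=; apply: lt_trans tk _.
  rewrite invf_plt ?posrE//.
  by have /andP[] : (Num.truncn e^-1)%:R <= e^-1 < (Num.truncn e^-1).+1%:R
    by apply: truncn_itv; rewrite invr_ge0 ltW.
rewrite eseries0// => k _ _; apply: (packing_premeasure_growth0 (b := b') (e0 := k.+1%:R^-1) L1f) => //.
- by move=> x [].
- by move=> x [].
Qed.

End packing_dimension_bound.

(** * Hausdorff and packing dimensions *)

Section hausdorff_packing.
Context (R : realType) (n : nat).
Implicit Types (E F U : set 'rV[R]_n) (s delta : R).

Lemma ediam_ge0 U : U !=set0 -> (0 <= ediam U)%E.
Proof.
move=> [x Ux]; apply: le_ereal_sup_tmp; exists (enorm (x - x))%:E.
  by exists x => //; exists x.
by rewrite lee_fin enorm_ge0.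
Qed.

Lemma diam_gauge_ge0 s U : (0 <= diam_gauge s U)%E.
Proof. by rewrite /diam_gauge; case: ifP => // _; exact: poweR_ge0. Qed.

Lemma diam_gauge0 s : diam_gauge s (set0 : set 'rV[R]_n) = 0%E.
Proof. by rewrite /diam_gauge asboolT. Qed.

Lemma ediam_set0 delta : (ediam (set0 : set 'rV[R]_n) <= delta%:E)%E.
Proof. by apply: ge_ereal_sup => _ [x []]. Qed.

Lemma diam_gauge_le s U delta : 0 <= s -> 0 <= delta ->
  (ediam U <= delta%:E)%E -> (diam_gauge s U <= (delta `^ s)%:E)%E.
Proof.
move=> s0 delta0 Ud; rewrite /diam_gauge; case: asboolP => [_|U0].
  by rewrite lee_fin powR_ge0.
have {}U0 : U !=set0 by apply/set0P/eqP.
rewrite -poweR_EFin; apply: gt0_ler_poweR => //.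
  by rewrite in_itv/= ediam_ge0//= leey.
by rewrite in_itv/= lee_fin delta0 leey.
Qed.

Lemma ediam_eclosed_ball c r : (ediam (eclosed_ball (c : 'rV[R]_n) r) <= (2 * r)%:E)%E.
Proof.
apply: ge_ereal_sup => _ [x xc] [y yc] <-; rewrite lee_fin.
apply: le_trans (ler_enorm_dist c _ _) _; rewrite mulr2n mulrDl mul1r lerD//.
by rewrite enorm_distC.
Qed.

(** An enumeration of [nat * nat] merges countably many covers into one, and the double series is
    rearranged as an unordered sum. *)
Lemma le_hausdorff_premeasure_bigcup s delta E (U : nat -> nat -> set 'rV[R]_n) :
  (forall i k, (ediam (U i k) <= delta%:E)%E) ->
  E `<=` \bigcup_i \bigcup_k U i k ->
  (hausdorff_premeasure s delta E <=
   \sum_(0 <= i <oo) \sum_(0 <= k <oo) diam_gauge s (U i k))%E.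
Proof.
move=> Ud EU.
have [f bf] : exists f : nat -> nat * nat, set_bij [set: nat] [set: nat * nat] f.
  by have /card_esym/ppcard_eqP[f] := card_nat2; exists f; exact: 'bij_f.
apply: ereal_inf_lbound; exists (fun m => U (f m).1 (f m).2).
  split=> [i|x /EU[i _ [k _ Ux]]]; first exact: Ud.
  have [_ _ /(_ (i, k) I)[m _ fm]] := bf.
  by exists m => //; rewrite fm.
rewrite nneseries_esumT; last by move=> m; exact: diam_gauge_ge0.
rewrite nneseries_esumT; last first.
  by move=> m; apply: nneseries_ge0 => k _ _; exact: diam_gauge_ge0.
transitivity (\esum_(i in [set: nat]) \esum_(k in [set: nat]) diam_gauge s (U i k)); last first.
  by apply: eq_esum => i _; rewrite nneseries_esumT// => k; exact: diam_gauge_ge0.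
rewrite esum_esum; last by move=> *; exact: diam_gauge_ge0.
have -> : [set: nat] `*`` (fun=> [set: nat]) = [set: nat * nat].
  by apply/seteqP; split.
by rewrite (@reindex_esum R _ _ _ _ _ (fun p => diam_gauge s (U p.1 p.2)) bf).
Qed.

Lemma le_packing_premeasure_at s delta delta' E : delta <= delta' ->
  (packing_premeasure_at s delta E <= packing_premeasure_at s delta' E)%E.
Proof.
move=> dd; apply: le_ereal_sup => _ [I [x [r [[h tI] ->]]]].
exists I, x, r; split => //; split => // i /h[Ei /andP[r0 rd]].
by rewrite r0 (le_trans rd).
Qed.

Lemma packing_premeasure_at_ge_equal s delta F (c : nat -> 'rV[R]_n) N : 0 < delta ->
  (forall i, (i < N)%N -> F (c i)) ->
  trivIset `I_N (fun i => eclosed_ball (c i) delta) ->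
  ((N%:R * (2 * delta) `^ s)%:E <= packing_premeasure_at s delta F)%E.
Proof.
move=> delta0 Fc tc; apply: ereal_sup_ubound; exists `I_N, c, (fun=> delta); split.
  by split => // i /Fc; rewrite delta0 lexx.
rewrite esum_fset//=; last by move=> i _; rewrite lee_fin powR_ge0.
by rewrite -fsbig_ord/= sumEFin sumr_const card_ord mulr_natl.
Qed.

(* Doubling the balls of a maximal disjoint family covers [F]. *)
Lemma maximal_disjoint_cover delta F (K : nat) :
  (forall N (c : nat -> 'rV[R]_n), (forall i, (i < N)%N -> F (c i)) ->
    trivIset `I_N (fun i => eclosed_ball (c i) delta) -> (N <= K)%N) ->
  exists N (c : nat -> 'rV[R]_n), [/\ forall i, (i < N)%N -> F (c i),
    trivIset `I_N (fun i => eclosed_ball (c i) delta) &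
    F `<=` \bigcup_(i < N) eclosed_ball (c i) (2 * delta)].
Proof.
move=> FK; pose P N := `[< exists c : nat -> 'rV[R]_n, (forall i, (i < N)%N -> F (c i)) /\
   trivIset `I_N (fun i => eclosed_ball (c i) delta) >].
have P0 : exists N, P N.
  by exists 0%N; apply/asboolP; exists (fun=> 0); split => // i j /=.
have bnd N : P N -> (N <= K)%N by move=> /asboolP[c [Fc tc]]; exact: FK Fc tc.
have [N PN maxN] := ex_maxnP P0 bnd.
move/asboolP: (PN) => [c [Fc tc]]; exists N, c; split => //.
move=> y Fy; apply: contrapT => ycov.
suff : P N.+1 by move/maxN; rewrite ltnn.
have disj i : (i < N)%N -> eclosed_ball (c i) delta `&` eclosed_ball y delta = set0.
  move=> iN; apply/seteqP; split => // z [zi zy]; apply: ycov; exists i => //.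
  rewrite /eclosed_ball/=; apply: le_trans (ler_enorm_dist z _ _) _.
  by rewrite mulr2n mulrDl mul1r lerD// enorm_distC.
apply/asboolP; exists (fun i => if (i < N)%N then c i else y); split => [i _|].
  by case: ifP => // /Fc.
apply/trivIsetP => i j /=; rewrite !ltnS => iN jN ij.
wlog lt_ij : i j iN jN ij / (i < j)%N.
  move=> W; have [/W|/W|/eqP] := ltngtP i j; rewrite ?(negbTE ij)//.
  - exact.
  - by rewrite setIC eq_sym; exact.
rewrite (leq_trans lt_ij)//; case: ifPn => jN'; last exact/disj/(leq_trans lt_ij).
by move/trivIsetP : tc => /(_ i j (ltn_trans lt_ij jN') jN' ij).
Qed.

Lemma maximal_packing_cover s delta F (M : R) : 0 < delta ->
  (packing_premeasure_at s delta F <= M%:E)%E ->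
  exists N (c : nat -> 'rV[R]_n), N%:R * (2 * delta) `^ s <= M /\
    F `<=` \bigcup_(i < N) eclosed_ball (c i) (2 * delta).
Proof.
move=> delta0 FM; have d0 : 0 < (2 * delta) `^ s by rewrite powR_gt0// mulr_gt0.
have PM N (c : nat -> 'rV[R]_n) : (forall i, (i < N)%N -> F (c i)) ->
    trivIset `I_N (fun i => eclosed_ball (c i) delta) -> N%:R * (2 * delta) `^ s <= M.
  move=> Fc tc; rewrite -lee_fin.
  exact: le_trans (packing_premeasure_at_ge_equal s delta0 Fc tc) FM.
have [N c Fc tc|N [c [Fc tc Fcov]]] :=
  @maximal_disjoint_cover delta F (Num.truncn (M / (2 * delta) `^ s)).
  have h := PM N c Fc tc; rewrite truncn_ge_nat ?ler_pdivlMr//.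
  by rewrite mul0r (le_trans _ h)// mulr_ge0// ltW.
by exists N, c; split => //; exact: PM Fc tc.
Qed.

(** Balls of radius [delta / 4] are packed, and their doubles have diameter at most [delta]. Passing
    from [(delta / 2)^s] to [delta^s] costs the factor [2^s]. *)
Lemma hausdorff_cover_of_packing s delta F (M : R) : 0 <= s -> 0 < delta ->
  (packing_premeasure_at s (delta / 4) F <= M%:E)%E ->
  exists U : nat -> set 'rV[R]_n, [/\ forall k, (ediam (U k) <= delta%:E)%E,
    F `<=` \bigcup_k U k &
    (\sum_(0 <= k <oo) diam_gauge s (U k) <= (2 `^ s * M)%:E)%E].
Proof.
move=> s0 delta0 /maximal_packing_cover[|N [c [NM Fcov]]].
  by rewrite divr_gt0.
pose U k := if (k < N)%N then eclosed_ball (c k) (2 * (delta / 4)) else set0.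
have Ud k : (ediam (U k) <= delta%:E)%E.
  rewrite /U; case: ifP => _; last exact: ediam_set0.
  apply: le_trans (ediam_eclosed_ball _ _) _; rewrite lee_fin; lra.
exists U; split => //.
  by move=> x /Fcov[i iN xi]; exists i => //; rewrite /U iN.
rewrite (nneseries_split 0 N); last by move=> k _; exact: diam_gauge_ge0.
rewrite [X in (_ + X)%E]eseries0; last first.
  by move=> k; rewrite add0n /U => Nk _; rewrite ltnNge Nk/= diam_gauge0.
rewrite adde0 add0n big_mkord.
apply: (@le_trans _ _ (\sum_(k < N) (delta `^ s)%:E)%E).
  by apply: lee_sum => k _; apply: diam_gauge_le => //; exact: ltW.
rewrite sumEFin sumr_const card_ord -[X in X%:E]mulr_natl lee_fin.
have -> : delta = 2 * (2 * (delta / 4)) by lra.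
by rewrite powRM ?mulr_ge0 ?divr_ge0 ?(ltW delta0)// mulrCA ler_wpM2l ?powR_ge0.
Qed.

Lemma hausdorff_premeasure_ge0 s delta E : (0 <= hausdorff_premeasure s delta E)%E.
Proof.
apply: le_ereal_inf_tmp => _ [U _ <-]; apply: nneseries_ge0 => i _ _.
exact: diam_gauge_ge0.
Qed.

Lemma packing_measure0_hausdorff s E : 0 <= s ->
  packing_measure s E = 0%E -> hausdorff_measure s E = 0%E.
Proof.
move=> s0 E0; apply/eqP; rewrite eq_le; apply/andP; split; last first.
  apply: le_ereal_sup_tmp; exists (hausdorff_premeasure s 1 E).
    by exists 1 => //=; exact: ltr01.
  exact: hausdorff_premeasure_ge0.
apply: ge_ereal_sup => _ [delta delta0 <-].
apply/lee_addgt0Pr => eps eps0; rewrite add0e.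
(* One [e] bounds the total premeasure of the pieces, another the errors [e / 2^(i+1)], and each is
   multiplied by [2^s]. *)
pose e := eps / (2 * 2 `^ s).
have e0 : 0 < e by rewrite divr_gt0// mulr_gt0// powR_gt0.
have [|_ [F EF <-]] := lb_ereal_inf_adherent e0 (_ : packing_measure s E \is a fin_num).
  by rewrite E0.
rewrite -/(packing_measure s E) E0 add0e => Fe.
have P0 i : (0 <= packing_premeasure s (F i))%E by exact: packing_premeasure_ge0.
have Pfin i : packing_premeasure s (F i) \is a fin_num.
  rewrite ge0_fin_numE//; apply: le_lt_trans (_ : _ <= e%:E)%E (ltry _).
  apply: le_trans (ltW Fe).
  rewrite (nneseries_split 0 i.+1)// add0n big_nat_recr//= -addeA addeCA.
  by rewrite leeDl// adde_ge0// ?sume_ge0// nneseries_ge0.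
pose p i := fine (packing_premeasure s (F i)) + e / (2 ^ i.+1)%:R.
have /choice[U hU] i : exists U : nat -> set 'rV[R]_n,
    [/\ forall k, (ediam (U k) <= delta%:E)%E, F i `<=` \bigcup_k U k &
    (\sum_(0 <= k <oo) diam_gauge s (U k) <= (2 `^ s * p i)%:E)%E].
  have ei0 : 0 < e / (2 ^ i.+1)%:R by rewrite divr_gt0// ltr0n expn_gt0.
  have [_ [del del0 <-] hdel] := lb_ereal_inf_adherent ei0 (Pfin i).
  (* [del' / 4 <= del] allows the packing bound at scale [del], by monotonicity in the scale, and
     [del' <= delta] keeps the cover admissible. *)
  pose del' := Num.min delta (4 * del).
  have del'0 : 0 < del' by rewrite lt_min delta0 mulr_gt0.
  have [|U [U1 U2 U3]] := @hausdorff_cover_of_packing s del' (F i) (p i) s0 del'0.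
    apply: (@le_trans _ _ (packing_premeasure_at s del (F i))).
      apply: le_packing_premeasure_at; rewrite ler_pdivrMr// mulrC.
      by rewrite ge_min lexx orbT.
    by rewrite EFinD fineK//; exact: ltW.
  exists U; split => // k; apply: le_trans (U1 k) _.
  by rewrite lee_fin ge_min lexx.
apply: (le_trans (@le_hausdorff_premeasure_bigcup s delta E U _ _)).
- by move=> i k; have [] := hU i.
- move=> x /EF[i _ Fx]; exists i => //; have [_ h _] := hU i; exact: h.
apply: (@le_trans _ _ (\sum_(0 <= i <oo) (2 `^ s)%:E * (p i)%:E)%E).
  apply: lee_nneseries => [i _ _|i _].
    by apply: nneseries_ge0 => k _ _; exact: diam_gauge_ge0.
  by have [_ _] := hU i; rewrite EFinM.
have p0 i : (0 <= (p i)%:E)%E.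
  by rewrite lee_fin addr_ge0// ?fine_ge0// divr_ge0// ltW.
rewrite nneseriesZl//.
apply: (@le_trans _ _ ((2 `^ s)%:E * (e%:E + e%:E))%E).
  rewrite lee_pmul2l ?lte_fin ?powR_gt0//.
  apply: le_trans (_ : (_ <= \sum_(0 <= i <oo) packing_premeasure s (F i) + e%:E)%E) _.
    apply: le_trans (epsilon_trick _ P0 (ltW e0)).
    by apply: lee_nneseries => // i _; rewrite /p EFinD fineK.
  by rewrite leeD2r// ltW.
rewrite -EFinD -EFinM lee_fin /e le_eqVlt; apply/orP; left; apply/eqP; field.
by rewrite lt0r_neq0// powR_gt0.
Qed.

Lemma hausdorff_dim_le_packing E : (hausdorff_dim E <= packing_dim E)%E.
Proof.
apply: le_ereal_inf => _ [s [s0 Es] <-]; exists s => //; split => //.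
exact: packing_measure0_hausdorff.
Qed.

Lemma le_packing_dim E F : E `<=` F -> (packing_dim E <= packing_dim F)%E.
Proof.
move=> EF; apply: le_ereal_inf => _ [s [s0 Fs] <-]; exists s => //; split => //.
apply/eqP; rewrite eq_le packing_measure_ge0 andbT -[leRHS]Fs.
apply: le_ereal_inf => _ [G FG <-]; exists G => //; exact: subset_trans EF FG.
Qed.

Lemma hausdorff_measure0_cover s E delta eps : 0 < delta -> 0 < eps ->
  hausdorff_measure s E = 0%E -> exists U : nat -> set 'rV[R]_n,
  [/\ forall i, (ediam (U i) <= delta%:E)%E, E `<=` \bigcup_i U i &
      (\sum_(0 <= i <oo) diam_gauge s (U i) < eps%:E)%E].
Proof.
move=> delta0 eps0 E0.
have H0 : hausdorff_premeasure s delta E = 0%E.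
  apply/eqP; rewrite eq_le hausdorff_premeasure_ge0 andbT -[leRHS]E0.
  by apply: ereal_sup_ubound; exists delta.
have [|_ [U [U1 U2] <-]] :=
  lb_ereal_inf_adherent eps0 (_ : hausdorff_premeasure s delta E \is a fin_num).
  by rewrite H0.
rewrite -/(hausdorff_premeasure s delta E) H0 add0e => U3.
by exists U.
Qed.

End hausdorff_packing.

(** * Coding by spread binary digits *)

Lemma powRD_gt0 (R : realType) (a x y : R) : 0 < a ->
  a `^ (x + y) = a `^ x * a `^ y.
Proof. by move=> a0; rewrite powRD// (gt_eqF a0) implybT. Qed.

Section digit_spreading.
Implicit Types (p : nat -> bool) (n i j : nat).

Definition count_upto p n : nat := \sum_(k < n) p k.

Lemma count_uptoS p n : count_upto p n.+1 = (count_upto p n + p n)%N.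
Proof. by rewrite /count_upto big_ord_recr. Qed.

(* The binary digits of [i] are copied, in order, to the positions [k < n] such
   that [p k] (counted from the leading one); the other positions get 0. *)
Fixpoint spread p n i : nat :=
  if n is m.+1 then
    if p m then (spread p m i./2).*2 + odd i else (spread p m i).*2
  else i.

(** The base case of [spread] keeps the leftover high digits, so strict monotonicity holds on all of
    [nat], without bounding [i] and [j] by [2^count]. *)
Lemma spread_lt p n i j : (i < j)%N -> (spread p n i < spread p n j)%N.
Proof.
elim: n i j => [//|n IH] i j ij /=; case: ifP => _.
  have : (i./2 <= j./2)%N by rewrite half_leq// ltnW.
  rewrite leq_eqVlt => /orP[/eqP ij2|/IH h].
    rewrite -ij2 ltn_add2l; move: ij.
    rewrite -{1}(odd_double_half i) -{1}(odd_double_half j) ij2 ltn_add2r.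
    by [].
  have h2 : (odd i <= 1)%N by case: (odd i).
  have := leq0n (odd j); lia.
by rewrite ltn_double IH.
Qed.

Lemma spread_eq p p' n : (forall k, (k < n)%N -> p k = p' k) ->
  spread p n =1 spread p' n.
Proof.
elim: n => [//|n IH] h i /=.
have hn : forall k, (k < n)%N -> p k = p' k by move=> k kn; apply: h; exact: ltnW.
by rewrite -h// !IH.
Qed.

Lemma count_upto_eq p p' n : (forall k, (k < n)%N -> p k = p' k) ->
  count_upto p n = count_upto p' n.
Proof. by move=> h; apply: eq_bigr => k _; rewrite h. Qed.

End digit_spreading.

Lemma truncn_half (R : realType) (t : R) : 0 <= t ->
  (Num.truncn (2 * t))./2 = Num.truncn t.
Proof.
move=> t0; apply/esym/eqP; rewrite truncn_eq//.
have /andP[h1 h2] : (Num.truncn (2 * t))%:R <= 2 * t < (Num.truncn (2 * t)).+1%:R.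
  by apply: truncn_itv; rewrite mulr_ge0.
set m := Num.truncn (2 * t) in h1 h2 *.
have h3 : (m./2).*2%:R <= m%:R :> R by rewrite ler_nat; lia.
have h4 : m.+1%:R <= (m./2.+1).*2%:R :> R by rewrite ler_nat; lia.
rewrite -!muln2 !natrM in h3 h4.
by apply/andP; split; lra.
Qed.

Section cantor_coding.
Context (R : realType) (p : nat -> bool).
Implicit Types (t u : R) (n : nat).

Definition code_digits n t : nat := spread p n (Num.truncn (2 ^+ count_upto p n * t)).

Definition code t : R := sup (range (fun n => (code_digits n t)%:R / 2 ^+ n)).

Lemma code_digitsS n t : 0 <= t ->
  exists b : bool, code_digits n.+1 t = ((code_digits n t).*2 + b)%N.
Proof.
move=> t0; rewrite /code_digits count_uptoS/=; case: (p n) => /=.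
  rewrite addn1 exprS -mulrA truncn_half ?mulr_ge0 ?exprn_ge0//.
  by eexists.
by exists false; rewrite !addn0.
Qed.

(** Appending one binary digit stays inside the current dyadic interval, so these intervals are
    nested. *)
Lemma code_digits_bounds n k t : 0 <= t ->
  (code_digits n t)%:R / 2 ^+ n <= (code_digits (n + k) t)%:R / 2 ^+ (n + k) :> R
  /\ (code_digits (n + k) t).+1%:R / 2 ^+ (n + k) <= (code_digits n t).+1%:R / 2 ^+ n :> R.
Proof.
move=> t0; elim: k => [|k [IH1 IH2]]; first by rewrite addn0.
rewrite addnS; have [b ->] := code_digitsS (n + k) t0.
have e (m : nat) : m%:R / 2 ^+ (n + k) = m.*2%:R / 2 ^+ (n + k).+1 :> R.
  rewrite exprS -muln2 natrM; field; by rewrite expf_neq0.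
split; [apply: le_trans IH1 _ | apply: le_trans _ IH2];
  rewrite e ler_pM2r ?invr_gt0 ?exprn_gt0// ler_nat; case: b; lia.
Qed.

Lemma code_digits_le n m t : 0 <= t ->
  (code_digits m t)%:R / 2 ^+ m <= (code_digits n t).+1%:R / 2 ^+ n :> R.
Proof.
move=> t0; have lt1 (k l : nat) : k%:R / 2 ^+ l <= k.+1%:R / 2 ^+ l :> R.
  by rewrite ler_pM2r ?invr_gt0 ?exprn_gt0// ler_nat.
have [nm|/ltnW mn] := leqP n m.
  have [_] := code_digits_bounds n (m - n) t0; rewrite subnKC//.
  exact: le_trans (lt1 _ _).
have [h _] := code_digits_bounds m (n - m) t0; rewrite subnKC// in h.
exact: le_trans h (lt1 _ _).
Qed.

Lemma code_has_sup t : 0 <= t -> has_sup (range (fun n => (code_digits n t)%:R / 2 ^+ n : R)).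
Proof.
move=> t0; split; first by exists ((code_digits 0 t)%:R / 2 ^+ 0); exists 0%N.
by exists ((code_digits 0 t).+1%:R / 2 ^+ 0) => _ [m _ <-]; exact: code_digits_le.
Qed.

Lemma code_ge n t : 0 <= t -> (code_digits n t)%:R / 2 ^+ n <= code t.
Proof. by move=> t0; apply: sup_upper_bound; [exact: code_has_sup|exists n]. Qed.

Lemma code_le n t : 0 <= t -> code t <= (code_digits n t).+1%:R / 2 ^+ n.
Proof.
move=> t0; apply: ge_sup.
  by exists ((code_digits 0 t)%:R / 2 ^+ 0); exists 0%N.
by move=> _ [m _ <-]; exact: code_digits_le.
Qed.

Lemma code_itv t : 0 <= t < 1 -> 0 <= code t <= 1.
Proof.
move=> /andP[t0 t1]; have e : code_digits 0 t = 0%N.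
  by rewrite /code_digits /count_upto big_ord0 expr0 mul1r/=; apply/eqP; rewrite truncn_eq// t0.
have := code_ge 0 t0; have := code_le 0 t0; rewrite e expr0 divr1 mul0r => -> ->.
by [].
Qed.

(** The gap forces the truncations of [t] and [u] to differ by at least 2. By strict monotonicity so
    do their spreads, which leaves a full dyadic interval of generation [n] between the two
    codes. *)
Lemma code_separated n t u : 0 <= t -> t + 2 / 2 ^+ count_upto p n <= u ->
  code t + 2^-1 ^+ n <= code u.
Proof.
move=> t0 tu; have u0 : 0 <= u.
  by apply: le_trans tu; rewrite addr_ge0// divr_ge0// exprn_ge0.
apply: le_trans (code_ge n u0).
apply: (@le_trans _ _ ((code_digits n t).+2%:R / 2 ^+ n)).
  have -> : (code_digits n t).+2%:R = (code_digits n t).+1%:R + 1 :> R by rewrite natr1.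
  by rewrite mulrDl mul1r exprVn lerD2r code_le.
rewrite ler_pM2r ?invr_gt0 ?exprn_gt0// ler_nat.
rewrite /code_digits; set c := 2 ^+ _ in tu *.
have c0 : 0 < c by rewrite exprn_gt0.
have h : ((Num.truncn (c * t)).+2 <= Num.truncn (c * u))%N.
  rewrite truncn_ge_nat ?mulr_ge0 ?(ltW c0)//.
  have /andP[h _] : (Num.truncn (c * t))%:R <= c * t < (Num.truncn (c * t)).+1%:R.
    by apply: truncn_itv; rewrite mulr_ge0 ?(ltW c0).
  have : c * (t + 2 / c) <= c * u by rewrite ler_pM2l.
  rewrite mulrDr [c * (2 / c)]mulrC divfK ?gt_eqF// -addn2 natrD; lra.
exact: leq_ltn_trans (spread_lt p n (ltnSn _)) (spread_lt p n h).
Qed.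

End cantor_coding.

(** * Sturmian patterns and the Hoelder exponent of decoding *)

Section sturmian_pattern.
Context (R : realType).
Implicit Types (th : R) (n k : nat).

(** The Sturmian (mechanical) word of slope [th]. For [th] in [0,1] its counts differ from [n th] by
    less than 1, so passing between digits and powers loses only constants. *)
Definition pattern th k := Num.truncn (k.+1%:R * th) != Num.truncn (k%:R * th).

Lemma count_pattern th n : 0 <= th <= 1 ->
  count_upto (pattern th) n = Num.truncn (n%:R * th).
Proof.
move=> /andP[th0 th1]; elim: n => [|n IH].
  by rewrite /count_upto big_ord0 mul0r truncn0.
rewrite count_uptoS IH /pattern.
have h1 : (Num.truncn (n%:R * th) <= Num.truncn (n.+1%:R * th))%N.
  by rewrite le_truncn// ler_wpM2r// ler_nat.
have h2 : (Num.truncn (n.+1%:R * th) <= (Num.truncn (n%:R * th)).+1)%N.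
  rewrite -ltnS truncn_lt_nat ?mulr_ge0//.
  have /andP[_ h] : (Num.truncn (n%:R * th))%:R <= n%:R * th < (Num.truncn (n%:R * th)).+1%:R.
    by apply: truncn_itv; rewrite mulr_ge0.
  rewrite -[n.+1%:R]natr1 mulrDl mul1r -[X in _ < X]natr1; lra.
by case: eqP => /= [->|]; lia.
Qed.

(* The best lower approximation of [th] with numerator and denominator at most
   [n] has the same pattern as [th] up to [n]. *)
Lemma pattern_approx th n : 0 <= th <= 1 -> exists q : 'I_n.+1 * 'I_n.+1,
  forall k, (k < n)%N -> pattern (q.1%:R / q.2%:R) k = pattern th k.
Proof.
move=> /andP[th0 th1].
pose F (q : 'I_n.+1 * 'I_n.+1) : R := q.1%:R / q.2%:R.
have P0 : F (ord0, ord0) <= th by rewrite /F mul0r.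
have [q Pq qmax] := @arg_maxP _ _ _ (ord0, ord0) (fun q => F q <= th) F P0.
have F0 q' : 0 <= F q' by rewrite divr_ge0.
have key k : (k <= n)%N -> Num.truncn (k%:R * F q) = Num.truncn (k%:R * th).
  move=> kn; apply/eqP; rewrite eqn_leq; apply/andP; split.
    by rewrite le_truncn// ler_wpM2l.
  have [->|k0] := posnP k; first by rewrite !mul0r.
  rewrite truncn_ge_nat ?mulr_ge0// -ler_pdivrMl ?ltr0n// mulrC.
  have /andP[h _] : (Num.truncn (k%:R * th))%:R <= k%:R * th < (Num.truncn (k%:R * th)).+1%:R.
    by apply: truncn_itv; rewrite mulr_ge0.
  have mn : (Num.truncn (k%:R * th) <= n)%N.
    rewrite -ltnS truncn_lt_nat ?mulr_ge0//.
    by apply: (@le_lt_trans _ _ k%:R); rewrite ?ler_piMr// ltr_nat ltnS.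
  have h' : F (inord (Num.truncn (k%:R * th)), inord k) <= th.
    by rewrite /F/= !inordK// ler_pdivrMr ?ltr0n// [th * _]mulrC.
  have : F (inord (Num.truncn (k%:R * th)), inord k) <= F q by exact: qmax.
  by rewrite {1}/F/= !inordK.
by exists q => k kn; rewrite /pattern -/(F q) !key// ltnW.
Qed.

(** The first generation whose parameter intervals are shorter than half of [|t - u|] separates the
    codes. The constant 8 is a product of three factors 2: from that separation, from
    [c n >= n th - 1], and from [2^(-th) >= 1/2]. *)
Lemma code_hoelder th t u : 0 < th <= 1 -> 0 <= t < 1 -> 0 <= u < 1 ->
  `|t - u| <= 8 * `|code (pattern th) t - code (pattern th) u| `^ th.
Proof.
move=> th01 t01 u01; have /andP[th0 th1] := th01.
wlog tu : t u t01 u01 / t < u.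
  move=> W; have [/W|/W|->] := ltgtP t u; first exact.
    by rewrite distrC [X in _ * X `^ _]distrC; exact.
  by rewrite subrr normr0 mulr_ge0 ?powR_ge0.
have /andP[t0 t1] := t01; have /andP[u0 u1] := u01.
pose c n := count_upto (pattern th) n.
have cE n : c n = Num.truncn (n%:R * th) by rewrite /c count_pattern// ltW.
have cth n : n%:R * th - 1 <= (c n)%:R.
  have /andP[_ h] : (Num.truncn (n%:R * th))%:R <= n%:R * th < (Num.truncn (n%:R * th)).+1%:R.
    by apply: truncn_itv; rewrite mulr_ge0// ltW.
  rewrite cE; rewrite -[X in _ < X]natr1 in h; lra.
have ut0 : 0 < u - t by rewrite subr_gt0.
have half01 : 0 < (2^-1 : R) <= 1 by rewrite invr_gt0 ltr0n invf_le1// ler1n.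
have pc n : 2^-1 ^+ c n <= 2 * 2^-1 `^ (n%:R * th) :> R.
  rewrite -powR_mulrn//.
  have -> : 2 * 2^-1 `^ (n%:R * th) = 2^-1 `^ (n%:R * th - 1) :> R.
    by rewrite powRD_gt0// powRN powRr1// invrK mulrC.
  exact: ger_powR.
have ex : exists n, 2 * 2^-1 ^+ c n <= u - t.
  have [j /andP[hj _]] : exists j, 2^-1 ^+ j.+1 < (u - t) / 4 <= 2^-1 ^+ j.
    by apply: expr2_bracket; apply/andP; split; lra.
  exists (Num.truncn (j.+1%:R / th)).+1; set n := (Num.truncn _).+1.
  have nth : j.+1%:R <= n%:R * th.
    rewrite -ler_pdivrMr//; apply: ltW.
    have /andP[] : (Num.truncn (j.+1%:R / th))%:R <= j.+1%:R / th < n%:R; last by [].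
    by apply: truncn_itv; rewrite divr_ge0// ltW.
  have cj : (j.+1 <= c n)%N by rewrite cE truncn_ge_nat// mulr_ge0// ltW.
  have : 2^-1 ^+ c n <= 2^-1 ^+ j.+1 :> R by rewrite ler_wiXn2l// invf_le1// ler1n.
  lra.
case: (ex_minnP ex) => n hn nmin.
(* Generation 0 is impossible, since [c 0 = 0] would give [2 <= u - t]. *)
case: n => [|n] in hn nmin *.
  by move: hn; rewrite cE mul0r truncn0 expr0; lra.
have hn' : u - t < 2 * 2^-1 ^+ c n.
  by rewrite ltNge; apply/negP => /nmin; rewrite ltnn.
have sep : code (pattern th) t + 2^-1 ^+ n.+1 <= code (pattern th) u.
  by apply: code_separated => //; rewrite -exprVn -/(c n.+1); lra.
have ->: `|t - u| = u - t by rewrite distrC gtr0_norm.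
set A := `|_ - _|.
have hA : 2^-1 ^+ n.+1 <= A.
  rewrite /A distrC ger0_norm; first lra.
  have : 0 <= 2^-1 ^+ n.+1 :> R by rewrite exprn_ge0.
  lra.
have : (2^-1 ^+ n.+1) `^ th <= A `^ th.
  by apply: ge0_ler_powR; rewrite ?nnegrE ?(ltW th0) ?exprn_ge0// normr_ge0.
have -> : (2^-1 ^+ n.+1) `^ th = 2^-1 `^ (n%:R * th) * 2^-1 `^ th :> R.
  rewrite -powR_mulrn// -powRrM -powRD_gt0//.
  by rewrite -[n.+1%:R]natr1 mulrDl mul1r.
have h2 : 2^-1 <= 2^-1 `^ th :> R.
  exact: ger1_powR.
have := pc n; have := powR_ge0 (2^-1 : R) (n%:R * th).
set B := 2^-1 `^ (n%:R * th); set X := 2^-1 `^ th in h2 *.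
nra.
Qed.

End sturmian_pattern.

(** * A chart of the sphere *)

Section sphere_chart.
Context (R : realType) (d : nat).
Implicit Types (y v : 'rV[R]_d).

Lemma sqr_enorm_consrow (a : R) v :
  enorm (consrow (a, v)) ^+ 2 = a ^+ 2 + enorm v ^+ 2.
Proof.
rewrite !sqr_enorm big_ord_recl consrow0; congr (_ + _).
by apply: eq_bigr => i _; rewrite consrowS.
Qed.

Lemma enorm_consrow_le (a : R) v : enorm (consrow (a, v)) <= `|a| + enorm v.
Proof.
rewrite -(@ler_pXn2r _ 2)// ?nnegrE ?addr_ge0 ?enorm_ge0//.
rewrite sqr_enorm_consrow sqrrD real_normK ?num_real// lerD2r lerDl.
by rewrite mulrn_wge0// mulr_ge0// enorm_ge0.
Qed.

(** A graph over part of the upper hemisphere. The factor [1 / (2 d)] sends the unit cube into the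
    ball of radius 1/2, away from the equator where the square root is singular. *)
Definition chart y : 'rV[R]_d.+1 :=
  let v := (2 * d%:R)^-1 *: y in consrow (Num.sqrt (1 - enorm v ^+ 2), v).

Hypothesis d_gt0 : (0 < d)%N.

Let d0 : 0 < d%:R :> R. Proof. by rewrite ltr0n. Qed.

Let enorm_half v (e : R) : 0 <= e -> (forall i, `|v ord0 i| <= e) ->
  enorm ((2 * d%:R)^-1 *: v) <= e / 2.
Proof.
move=> e0 h; rewrite enormZ gtr0_norm ?invr_gt0 ?mulr_gt0//.
apply: le_trans (ler_wpM2l _ (enorm_le_coord e0 h)) _.
  by rewrite invr_ge0 mulr_ge0// ltW.
rewrite le_eqVlt; apply/orP; left; apply/eqP; field.
by rewrite lt0r_neq0.
Qed.

Let chart_half y : (forall i, 0 <= y ord0 i <= 1) -> enorm ((2 * d%:R)^-1 *: y) <= 2^-1.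
Proof.
move=> h; rewrite -[leRHS]mul1r; apply: enorm_half => // i.
by have /andP[h0 h1] := h i; rewrite ger0_norm.
Qed.

Let sqr_half (a : R) : 0 <= a <= 2^-1 -> a ^+ 2 <= 4^-1.
Proof.
move=> /andP[a0 a1]; have -> : 4^-1 = 2^-1 ^+ 2 :> R by field.
by rewrite lerXn2r// nnegrE.
Qed.

Lemma chart_esphere y : (forall i, 0 <= y ord0 i <= 1) -> esphere R d.+1 (chart y).
Proof.
move=> /chart_half h; rewrite /esphere/= /chart.
set v := _ *: y in h *.
have v4 : enorm v ^+ 2 <= 4^-1 by apply: sqr_half; rewrite enorm_ge0.
have : enorm (consrow (Num.sqrt (1 - enorm v ^+ 2), v)) ^+ 2 = 1 ^+ 2.
  rewrite sqr_enorm_consrow sqr_sqrtr ?subrK ?expr1n//; lra.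
by move/eqP; rewrite eqrXn2 ?enorm_ge0// => /eqP.
Qed.

Lemma consrowB (a b : R) v w : consrow (a, v) - consrow (b, w) = consrow (a - b, v - w).
Proof.
apply/rowP => i; case: (unliftP ord0 i) => [j|] ->.
  by rewrite [LHS]mxE [X in _ + X]mxE !consrowS/= !mxE.
by rewrite [LHS]mxE [X in _ + X]mxE !consrow0.
Qed.

(** Half of [e] bounds the change of [v], the other half that of the height: heights [a], [b]
    satisfy [|a - b| (a + b) = ||v| - |w|| (|v| + |w|)] with [a + b >= 1] and [|v| + |w| <= 1]. *)
Lemma chart_lipschitz y y' (e : R) : 0 <= e ->
  (forall i, 0 <= y ord0 i <= 1) -> (forall i, 0 <= y' ord0 i <= 1) ->
  (forall i, `|y ord0 i - y' ord0 i| <= e) -> enorm (chart y - chart y') <= e.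
Proof.
move=> e0 hy hy' h; rewrite /chart consrowB -scalerBr.
have hd : enorm ((2 * d%:R)^-1 *: (y - y')) <= e / 2.
  by apply: enorm_half => // i; rewrite !mxE.
apply: le_trans (enorm_consrow_le _ _) _.
have -> : e = e / 2 + e / 2 by lra.
rewrite lerD//; move: hd; rewrite scalerBr.
have := chart_half hy; have := chart_half hy'.
set v := _ *: y; set w := _ *: y' => w2 v2 hd.
have wv : `|enorm v - enorm w| <= e / 2 by apply: le_trans hd; exact: ler_dist_enorm.
have v4 : enorm v ^+ 2 <= 4^-1 by apply: sqr_half; rewrite enorm_ge0.
have w4 : enorm w ^+ 2 <= 4^-1 by apply: sqr_half; rewrite enorm_ge0.
have v0 := enorm_ge0 v; have w0 := enorm_ge0 w.
have sv : 2^-1 <= Num.sqrt (1 - enorm v ^+ 2).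
  have -> : 2^-1 = Num.sqrt (2^-1 ^+ 2) :> R by rewrite sqrtr_sqr ger0_norm.
  by rewrite ler_sqrt; lra.
have sw : 2^-1 <= Num.sqrt (1 - enorm w ^+ 2).
  have -> : 2^-1 = Num.sqrt (2^-1 ^+ 2) :> R by rewrite sqrtr_sqr ger0_norm.
  by rewrite ler_sqrt; lra.
set a := Num.sqrt _ in sv *; set b := Num.sqrt _ in sw *.
have a2 : a ^+ 2 = 1 - enorm v ^+ 2 by rewrite sqr_sqrtr//; lra.
have b2 : b ^+ 2 = 1 - enorm w ^+ 2 by rewrite sqr_sqrtr//; lra.
have ab : `|a - b| * (a + b) = `|enorm v - enorm w| * (enorm v + enorm w).
  rewrite -[X in _ * X](@ger0_norm _ (a + b)); last lra.
  rewrite -[X in _ = _ * X](@ger0_norm _ (enorm v + enorm w)); last lra.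
  by rewrite -!normrM -!subr_sqr a2 b2 distrC; congr `|_|; ring.
have h1 : `|a - b| <= `|a - b| * (a + b) by rewrite ler_peMr//; lra.
have h2 : `|enorm v - enorm w| * (enorm v + enorm w) <= `|enorm v - enorm w|.
  by rewrite ler_piMr//; lra.
by rewrite (le_trans h1)// ab (le_trans h2).
Qed.

Lemma chart_expand y y' i :
  `|y ord0 i - y' ord0 i| <= 2 * d%:R * enorm (chart y - chart y').
Proof.
rewrite -ler_pdivrMl ?mulr_gt0//; rewrite /chart consrowB -scalerBr.
apply: le_trans (coord_le_enorm _ (lift ord0 i)).
rewrite consrowS/= !mxE normrM gtr0_norm// invr_gt0 mulr_gt0//.
Qed.

End sphere_chart.

Section grid_points.
Context (R : realType) (d : nat) (p : nat -> bool).

Definition coded_point (t : 'rV[R]_d) : 'rV[R]_d.+1 :=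
  chart (\row_i code p (t ord0 i)).

Definition grid_point n (I : {ffun 'I_d -> 'I_(2 ^ count_upto p n)}) : 'rV[R]_d.+1 :=
  chart (\row_i ((spread p n (I i))%:R / 2 ^+ n)).

Hypothesis d_gt0 : (0 < d)%N.

Lemma coded_point_esphere (t : 'rV[R]_d) : (forall i, 0 <= t ord0 i < 1) ->
  esphere R d.+1 (coded_point t).
Proof. by move=> h; apply: chart_esphere => // i; rewrite mxE code_itv. Qed.

Lemma spread_itv n m : (m < 2 ^ count_upto p n)%N ->
  0 <= ((spread p n m)%:R / 2 ^+ n : R) <= 1.
Proof.
move=> mc; rewrite divr_ge0 ?exprn_ge0//=.
(* The grid value is the generation [n] lower approximation of the code of this [t]. *)
pose t : R := m%:R / 2 ^+ count_upto p n.
have t01 : 0 <= t < 1.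
  rewrite divr_ge0 ?exprn_ge0//= ltr_pdivrMr ?exprn_gt0// mul1r -natrX.
  by rewrite ltr_nat.
have /andP[t0 _] := t01; have /andP[_ c1] := code_itv p t01.
apply: le_trans c1; have := code_ge p n t0.
rewrite /code_digits.
have -> : 2 ^+ count_upto p n * t = m%:R by rewrite mulrC /t divfK// expf_neq0.
by rewrite natrK.
Qed.

Lemma grid_point_esphere n I : esphere R d.+1 (@grid_point n I).
Proof. by apply: chart_esphere => // i; rewrite mxE spread_itv. Qed.

End grid_points.


(** Cutting the code after [n] digits gives a grid point that depends only on the pattern below [n].
    This is what lets finitely many patterns serve all slopes. *)
Lemma coded_point_near_grid (R : realType) d (p p' : nat -> bool) n (t : 'rV[R]_d) :
  (0 < d)%N -> (forall k, (k < n)%N -> p' k = p k) -> (forall i, 0 <= t ord0 i < 1) ->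
  exists I, enorm (coded_point p t - grid_point R (p := p') (n := n) I) <= 2^-1 ^+ n.
Proof.
move=> d_gt0 pp' t01.
have c0 : 0 < 2 ^+ count_upto p n :> R by rewrite exprn_gt0.
have lt_c i : (Num.truncn (2 ^+ count_upto p n * t ord0 i) < 2 ^ count_upto p' n)%N.
  have /andP[t0 t1] := t01 i; rewrite (count_upto_eq pp').
  by rewrite truncn_lt_nat ?mulr_ge0 ?(ltW c0)// natrX gtr_pMr.
exists [ffun i => Ordinal (lt_c i)].
apply: (chart_lipschitz d_gt0); rewrite ?exprn_ge0//.
- by move=> i; rewrite mxE code_itv.
- by move=> i; rewrite mxE spread_itv.
move=> i; rewrite !mxE ffunE/= (spread_eq pp'); have /andP[t0 t1] := t01 i.
have := code_ge p n t0; have := code_le p n t0; rewrite /code_digits.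
set m := spread _ _ _; rewrite -[m.+1%:R]natr1 mulrDl mul1r -exprVn => h1 h2.
by rewrite ger0_norm ?subr_ge0//; lra.
Qed.

(** * The saturating function *)

Section saturating_function.
Context (R : realType) (d : nat).
Local Notation S := (esphere R d.+1).
Local Notation sigma := (sphere_measure R d.+1).

Definition ratio n (q : 'I_n.+1 * 'I_n.+1) : R := q.1%:R / q.2%:R.
Local Notation pat q := (pattern (ratio q)).

(* The caps of generation [n] for the pattern [q] carry the mass
   [1 / ((n+1)(n+2)(n+1)^2)] in total, and [\sum_n 1 / ((n+1)(n+2)) = 1]. *)
Definition cap_height n (q : 'I_n.+1 * 'I_n.+1) : R :=
  (n.+1%:R * n.+2%:R)^-1 * (n.+1%:R ^+ 2)^-1 *
  ((2 ^+ n) ^+ d / (2 ^+ count_upto (pat q) n) ^+ d).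

Definition cap_bump n (q : 'I_n.+1 * 'I_n.+1)
    (I : {ffun 'I_d -> 'I_(2 ^ count_upto (pat q) n)}) (x : 'rV[R]_d.+1) : R :=
  cap_height q * \1_(eclosed_ball (grid_point R I) (2^-1 ^+ n)) x.

Definition generation n (x : 'rV[R]_d.+1) : R := \sum_q \sum_I @cap_bump n q I x.

Definition saturating_ext (x : 'rV[R]_d.+1) : \bar R :=
  (\sum_(0 <= n <oo) (generation n x)%:E)%E.

(** Where the series diverges, [fine] gives 0; integrability makes this a null set. *)
Definition saturating (x : 'rV[R]_d.+1) : R := fine (saturating_ext x).

Lemma cap_height_gt0 n (q : 'I_n.+1 * 'I_n.+1) : 0 < cap_height q.
Proof.
by rewrite /cap_height !mulr_gt0 ?invr_gt0 ?mulr_gt0 ?exprn_gt0 ?ltr0n.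
Qed.

Lemma cap_bump_ge0 n q I x : 0 <= @cap_bump n q I x.
Proof. by rewrite mulr_ge0// ltW// cap_height_gt0. Qed.

Lemma generation_ge0 n x : 0 <= generation n x.
Proof. by rewrite sumr_ge0// => q _; rewrite sumr_ge0// => I _; exact: cap_bump_ge0. Qed.

Lemma cap_bump_le n q I x : ((@cap_bump n q I x)%:E <= saturating_ext x)%E.
Proof.
rewrite /saturating_ext (nneseries_split 0 n.+1); last first.
  by move=> k _; rewrite lee_fin generation_ge0.
rewrite add0n big_nat_recr//= -addeA addeCA.
apply: le_trans (leeDl _ _); last first.
  by rewrite adde_ge0 ?sume_ge0 ?nneseries_ge0// => *; rewrite lee_fin generation_ge0.
rewrite lee_fin /generation (bigD1 q)//= (bigD1 I)//= -addrA lerDl.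
rewrite addr_ge0 ?sumr_ge0// => *; first exact: cap_bump_ge0.
by rewrite sumr_ge0// => *; exact: cap_bump_ge0.
Qed.

Lemma saturating_ext_ge0 x : (0 <= saturating_ext x)%E.
Proof. by apply: nneseries_ge0 => n _ _; rewrite lee_fin generation_ge0. Qed.

Lemma saturating_ge0 x : 0 <= saturating x.
Proof. by rewrite fine_ge0// saturating_ext_ge0. Qed.

Lemma measurable_cap_bump n q I : measurable_fun S (@cap_bump n q I).
Proof.
apply: measurable_funM => //.
by apply: measurable_indic; exact: measurable_eclosed_ball.
Qed.

Lemma measurable_generation n : measurable_fun S (generation n).
Proof.
apply: measurable_sum => q; apply: measurable_sum => I.
exact: measurable_cap_bump.
Qed.

Lemma measurable_saturating_ext : measurable_fun S saturating_ext.
Proof.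
apply: ge0_emeasurable_sum => [n x _ _|n _]; first by rewrite lee_fin generation_ge0.
by apply/measurable_EFinP; exact: measurable_generation.
Qed.

Hypothesis d_gt0 : (0 < d)%N.

Lemma sphere_measure_setIS A : sigma (A `&` S) = sigma A.
Proof.
rewrite /sphere_measure; congr (_ * _)%E; congr (rV_lebesgue _).
apply/seteqP; split => x [x01]; first by case.
move=> Ax; split => //; split => //; case/andP: x01 => x0 _.
by rewrite /esphere/= enormZ gtr0_norm ?invr_gt0// mulVf// gt_eqF.
Qed.

(** [cap_height] is chosen so that everything cancels: the measure of a cap against [(2^n)^d], the
    number of caps against [(2^count)^d], and the number of patterns against [(n+1)^2]. *)
Lemma integral_generation_le : exists2 C : R, 0 < C & forall n,
  (\int[sigma]_(x in S) (generation n x)%:E <= (C / (n.+1%:R * n.+2%:R))%:E)%E.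
Proof.
have [C C0 hC] := cap_ub R d; exists C => // n.
have mS := @measurable_esphere R d.+1.
have e0 : 0 < 2 ^+ n :> R by rewrite exprn_gt0.
have le_bump q I : (\int[sigma]_(x in S) (@cap_bump n q I x)%:E <=
    (cap_height q * (C * (2^-1 ^+ n) ^+ d))%:E)%E.
  under eq_integral do rewrite EFinM.
  rewrite ge0_integralZl//=; last 2 first.
  - by apply/measurable_EFinP/measurable_indic; exact: measurable_eclosed_ball.
  - by rewrite lee_fin ltW// cap_height_gt0.
  rewrite integral_indic//; last exact: measurable_eclosed_ball.
  rewrite [leRHS]EFinM; apply: lee_wpmul2l; first by rewrite lee_fin ltW// cap_height_gt0.
  rewrite [leLHS]sphere_measure_setIS hC ?exprn_gt0 ?invr_gt0//.
  exact: grid_point_esphere.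
rewrite /generation.
under eq_integral do rewrite -sumEFin.
rewrite ge0_integral_sum//; last 2 first.
- move=> q; apply/measurable_EFinP; apply: measurable_sum => I.
  exact: measurable_cap_bump.
- by move=> q x _; rewrite lee_fin sumr_ge0// => I _; exact: cap_bump_ge0.
apply: (@le_trans _ _ (\sum_(q : 'I_n.+1 * 'I_n.+1)
    (C / (n.+1%:R * n.+2%:R) / n.+1%:R ^+ 2)%:E)%E).
  apply: lee_sum => q _.
  under eq_integral do rewrite -sumEFin.
  rewrite ge0_integral_sum//; last 2 first.
  - by move=> I; apply/measurable_EFinP; exact: measurable_cap_bump.
  - by move=> I x _; rewrite lee_fin; exact: cap_bump_ge0.
  apply: le_trans (lee_sum _ (fun I _ => le_bump q I)) _.
  rewrite sumEFin sumr_const card_ffun !card_ord lee_fin -[leLHS]mulr_natl.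
  rewrite le_eqVlt; apply/orP; left; apply/eqP.
  rewrite /cap_height natrX natrX exprVn exprVn.
  set a := (_ ^+ count_upto _ _) ^+ d; set b := (2 ^+ n) ^+ d.
  have a0 : a != 0 by rewrite !expf_neq0.
  have b0 : b != 0 by rewrite !expf_neq0.
  have n1 : n.+1%:R != 0 :> R by [].
  have n2 : n.+2%:R != 0 :> R by [].
  move: n1 n2; move: (n.+1%:R : R) (n.+2%:R : R) => x y n1 n2; field.
  by rewrite n1 n2 b0 a0.
rewrite sumEFin sumr_const card_prod !card_ord lee_fin -[leLHS]mulr_natl.
by rewrite natrM -expr2 mulrC divfK// expf_neq0.
Qed.

Lemma integral_saturating_ext_lty : (\int[sigma]_(x in S) saturating_ext x < +oo)%E.
Proof.
have [C C0 hC] := integral_generation_le.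
have mS := @measurable_esphere R d.+1.
rewrite /saturating_ext integral_nneseries//; last 2 first.
- by move=> n; apply/measurable_EFinP; exact: measurable_generation.
- by move=> n x _; rewrite lee_fin generation_ge0.
apply: le_lt_trans (ltry C).
apply: lime_le.
  by apply: is_cvg_nneseries => n _ _; apply: integral_ge0 => x _; rewrite lee_fin generation_ge0.
apply: nearW => N; rewrite big_mkord.
apply: le_trans (lee_sum _ (fun (k : 'I_N) _ => hC k)) _.
rewrite sumEFin lee_fin -mulr_sumr -[leRHS]mulr1 ler_pM2l//.
have -> : \sum_(k < N) (k.+1%:R * k.+2%:R)^-1 = 1 - N.+1%:R^-1 :> R.
  elim: N => [|N IH]; first by rewrite big_ord0 invr1 subrr.
  rewrite big_ord_recr/= IH.
  have n1 : N.+1%:R != 0 :> R by [].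
  have n2 : N.+2%:R != 0 :> R by [].
  rewrite -[N.+2%:R]natr1 in n2 *; move: n1 n2; move: (N.+1%:R) => x n1 n2.
  by field; rewrite n1 n2.
by rewrite gerBl.
Qed.

Lemma saturating_ext_integrable : sigma.-integrable S saturating_ext.
Proof.
apply/integrableP; split; first exact: measurable_saturating_ext.
under eq_integral do rewrite gee0_abs ?saturating_ext_ge0//.
exact: integral_saturating_ext_lty.
Qed.

Lemma saturating_L1 : L1_sphere saturating.
Proof.
have mS := @measurable_esphere R d.+1.
have mf : measurable_fun S saturating.
  apply: (@measurableT_comp _ _ _ _ _ _ (@fine R)).
    exact: fine_measurable.
  exact: measurable_saturating_ext.
apply: (le_integrable mS _ _ saturating_ext_integrable).
  exact/measurable_EFinP.
move=> x _; rewrite /= ger0_norm ?saturating_ge0// gee0_abs ?saturating_ext_ge0//.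
rewrite /saturating; have := saturating_ext_ge0 x.
by case: (saturating_ext x) => //= *; rewrite leey.
Qed.

Lemma saturating_fin : {ae sigma, forall x, S x -> saturating_ext x \is a fin_num}.
Proof.
apply: integrable_ae; first exact: measurable_esphere.
exact: saturating_ext_integrable.
Qed.

(** Everything being nonnegative, a single cap is kept; its points are within [rho + 2^(-n)] of
    [x]. *)
Lemma poisson_saturating_ge (x : 'rV[R]_d.+1) (r rho c : R) n
    (q : 'I_n.+1 * 'I_n.+1) (I : {ffun 'I_d -> 'I_(2 ^ count_upto (pat q) n)}) : S x ->
  0 < r <= 1 -> 0 <= rho -> enorm (x - @grid_point R d _ n I) <= rho ->
  (c%:E <= sigma (eclosed_ball (grid_point R I) (2^-1 ^+ n)))%E ->
  r / (r + (rho + 2^-1 ^+ n)) ^+ d.+1 * (cap_height q * c) <=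
  poisson_integral saturating ((1 - r) *: x).
Proof.
move=> Sx r01 rho0 xz hc; have /andP[r0 r1] := r01.
have mS := @measurable_esphere R d.+1.
pose B := eclosed_ball (grid_point R I) (2^-1 ^+ n).
have mB : measurable B by exact: measurable_eclosed_ball.
pose k0 := r / (r + (rho + 2^-1 ^+ n)) ^+ d.+1.
have en : 0 < 2^-1 ^+ n :> R by rewrite exprn_gt0// invr_gt0.
have D0 : 0 < r + (rho + 2^-1 ^+ n) by rewrite addr_gt0// ltr_wpDl.
have k00 : 0 < k0 by rewrite divr_gt0// exprn_gt0.
pose g xi := poisson_kernel ((1 - r) *: x) xi * saturating xi.
have mg : measurable_fun S g.
  by apply: measurable_poisson_mul; exact: measurable_fun_L1 saturating_L1.
have g0 xi : 0 <= g xi by rewrite mulr_ge0 ?saturating_ge0 ?poisson_kernel_ge0.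
(* Finiteness is essential for a lower bound: [fine] would turn an infinite integral into 0. *)
have gfin : (\int[sigma]_(xi in S) (g xi)%:E)%E \is a fin_num.
  rewrite ge0_fin_numE; last by apply: integral_ge0 => *; rewrite lee_fin.
  pose M := 2 * 3 ^+ d.+1 * (r / r ^+ d.+1).
  have M0 : 0 <= M by rewrite !mulr_ge0 ?invr_ge0 ?exprn_ge0 ?(ltW r0).
  have /integrableP[mf foo] := saturating_L1.
  apply: (@le_lt_trans _ _ (M%:E * \int[sigma]_(xi in S) `|(EFin \o saturating) xi|)%E).
    rewrite -ge0_integralZl//; last exact: measurableT_comp.
    apply: ge0_le_integral => //.
    - by move=> *; rewrite lee_fin.
    - exact/measurable_EFinP.
    - by apply: measurable_funeM; exact: measurableT_comp.
    - move=> xi Sxi /=; rewrite -EFinM lee_fin ger0_norm ?saturating_ge0//.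
      by rewrite ler_wpM2r ?saturating_ge0// poisson_kernel_le_cst.
  by rewrite lte_mul_pinfty.
have kc : 0 < k0 * cap_height q by rewrite mulr_gt0// cap_height_gt0.
rewrite -lee_fin /poisson_integral /Rintegral fineK//.
apply: (@le_trans _ _ (\int[sigma]_(xi in S) ((k0 * cap_height q)%:E * (\1_B xi)%:E))%E).
  rewrite ge0_integralZl//; last 2 first.
  - exact/measurable_EFinP/measurable_indic.
  - by rewrite lee_fin mulr_ge0// ltW// cap_height_gt0.
  rewrite integral_indic// -/k0 mulrA EFinM.
  rewrite lee_pmul2l ?lte_fin//.
  by rewrite [leRHS]sphere_measure_setIS.
apply: ae_ge0_le_integral => //.
- by move=> xi _; rewrite mule_ge0// lee_fin ltW.
- by apply: measurable_funeM; apply/measurable_EFinP; exact: measurable_indic.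
- by move=> xi _; rewrite lee_fin g0.
- exact/measurable_EFinP.
apply: filterS saturating_fin => xi fin Sxi; rewrite -EFinM lee_fin.
have [xiB|xiB] := pselect (B xi); last by rewrite indicE memNset// mulr0 g0.
rewrite -mulrA; apply: ler_pM.
- exact: ltW.
- by rewrite mulr_ge0// ltW// cap_height_gt0.
- apply: le_trans (poisson_kernel_ge Sx Sxi r01).
  rewrite /k0 ler_pM2l// lef_pV2 ?posrE ?exprn_gt0//; last first.
    by rewrite ltr_pwDl// enorm_ge0.
  rewrite lerXn2r ?nnegrE ?(ltW D0)//; first by rewrite addr_ge0 ?enorm_ge0// ltW.
  rewrite lerD2l; apply: le_trans (ler_enorm_dist (grid_point R I) _ _) _.
  by rewrite lerD// enorm_distC.
- by rewrite -lee_fin /saturating fineK ?fin//; exact: cap_bump_le.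
Qed.

End saturating_function.

(** * Growth on the Cantor sets *)

(** Since [exp x >= x^5 / 5!], the exponential beats the power 4, which bounds the weight loss
    [(n+1)^3 (n+2)]. *)
Lemma poly_le_powR2 (R : realType) (a M : R) : 0 < a -> 0 <= M ->
  exists n0, forall n, (n0 <= n)%N -> M * n.+2%:R ^+ 4 <= 2 `^ (n%:R * a).
Proof.
move=> a0 M0; pose u := a * ln 2.
have l2 : 0 < ln 2 :> R by rewrite ln_gt0// ltr1n.
have u0 : 0 < u by rewrite mulr_gt0.
have [F F0 hF] : exists2 F : R, 0 < F & forall x, 0 <= x -> x ^+ 5 / F <= expR x.
  exists (5`!)%:R => [|x x0]; first by rewrite ltr0n fact_gt0.
  by apply: le_trans (expR_ge1Dxn 4 x0); rewrite lerDr.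
have [T T0 hT] : exists2 T : R, 0 < T &
    forall n, (2 <= n)%N -> n.+2%:R ^+ 4 <= T * n%:R ^+ 4.
  exists (2 ^+ 4) => [|n n2]; first by rewrite exprn_gt0.
  rewrite -exprMn lerXn2r ?nnegrE ?mulr_ge0// -natrM ler_nat mul2n -addnn.
  by rewrite -addn2 leq_add2l.
have u5 : 0 < u ^+ 5 by rewrite exprn_gt0.
have q0 : 0 <= M * T * F / u ^+ 5.
  by rewrite divr_ge0 ?(ltW u5)// !mulr_ge0 ?(ltW T0) ?(ltW F0).
exists (maxn 2 (Num.truncn (M * T * F / u ^+ 5)).+1) => n.
rewrite geq_max => /andP[n2 nk].
have nM : M * T * F <= n%:R * u ^+ 5.
  rewrite -ler_pdivrMr//; have /andP[_ h] := truncn_itv q0.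
  by apply: ltW; apply: lt_le_trans h _; rewrite ler_nat.
have x0 : 0 <= n%:R * a * ln 2 by rewrite !mulr_ge0// ltW.
rewrite /powR pnatr_eq0/=; apply: le_trans (hF _ x0).
rewrite ler_pdivlMr//.
have -> : (n%:R * a * ln 2) ^+ 5 = n%:R ^+ 4 * (n%:R * u ^+ 5) by rewrite /u; ring.
apply: le_trans (ler_wpM2l _ nM); last by rewrite exprn_ge0.
apply: (@le_trans _ _ (M * (T * n%:R ^+ 4) * F)).
  by rewrite ler_pM2r// ler_wpM2l// hT.
by rewrite le_eqVlt; apply/orP; left; apply/eqP; ring.
Qed.

Lemma powR_dyadic_le (R : realType) (del r a : R) : 0 < r -> del / 2 <= r <= del ->
  r `^ a <= del `^ a * 2 `^ `|a|.
Proof.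
move=> r0 /andP[r1 r2].
have d0 : 0 < del by exact: lt_le_trans r2.
have s0 : 0 < del / r by rewrite divr_gt0.
have s1 : 1 <= del / r by rewrite ler_pdivlMr// mul1r.
have s2 : del / r <= 2 by rewrite ler_pdivrMr// mulrC; lra.
have -> : r = del * (del / r)^-1 by rewrite invf_div mulrC divfK// gt_eqF.
rewrite powRM ?(ltW d0) ?invr_ge0 ?(ltW s0)//.
rewrite ler_pM2l ?powR_gt0// -powR_inv1 ?(ltW s0)// -powRrM mulN1r.
apply: (@le_trans _ _ ((del / r) `^ `|a|)).
  by apply: ler_powR => //; rewrite -normrN ler_norm.
by apply: ge0_ler_powR; rewrite ?nnegrE ?(ltW s0).
Qed.

Section growth_on_cantor_sets.
Context (R : realType) (d : nat).
Hypothesis d_gt0 : (0 < d)%N.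
Local Notation S := (esphere R d.+1).
Local Notation sigma := (sphere_measure R d.+1).
Local Notation f := (@saturating R d).

(** At scale [2^(-n)] the kernel times the measure of one nearby cap is bounded below ([k1]), so the
    cap height alone gives the growth ([k2], using [floor(n th) <= n th]). *)
Lemma poisson_saturating_coded_ge (th : R) : 0 <= th <= 1 -> exists2 K : R, 0 < K &
  forall (t : 'rV[R]_d) n r, (forall i, 0 <= t ord0 i < 1) ->
    2^-1 ^+ n.+1 <= r <= 2^-1 ^+ n ->
    K / n.+2%:R ^+ 4 * 2 `^ (n%:R * (d%:R * (1 - th))) <=
    poisson_integral f ((1 - r) *: coded_point (pattern th) t).
Proof.
move=> th01; have [c c0 hc] := cap_lb R d; have /andP[th0 th1] := th01.
exists (c / (2 * 3 ^+ d.+1)); first by rewrite divr_gt0 ?mulr_gt0 ?exprn_gt0.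
move=> t n r t01 /andP[rn1 rn2]; have [q hq] := pattern_approx n th01.
have [I hI] := coded_point_near_grid d_gt0 hq t01.
set e := 2^-1 ^+ n in rn2 hI *; have e0 : 0 < e by rewrite exprn_gt0 ?invr_gt0.
have e1 : e <= 1 by rewrite /e exprn_ile1// invf_le1// ler1n.
have r0 : 0 < r by apply: lt_le_trans rn1; rewrite exprn_gt0 ?invr_gt0.
have r01 : 0 < r <= 1 by rewrite r0 (le_trans rn2).
have Sx := coded_point_esphere (pattern th) d_gt0 t01.
have hB : ((c * e ^+ d)%:E <= sigma (eclosed_ball (grid_point R I) e))%E.
  by apply: hc; [exact: grid_point_esphere|rewrite e0 e1].
apply: le_trans (poisson_saturating_ge d_gt0 Sx r01 (ltW e0) hI hB).
have cq : count_upto (pattern (@ratio R n q)) n = Num.truncn (n%:R * th).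
  by rewrite (count_upto_eq hq) count_pattern.
rewrite -/e; set x := n.+2%:R ^+ 4.
have k1 : (2 * 3 ^+ d.+1)^-1 / e ^+ d <= r / (r + (e + e)) ^+ d.+1.
  rewrite -invfM -[leRHS]invf_div lef_pV2 ?posrE; last 2 first.
  - by rewrite !mulr_gt0 ?exprn_gt0.
  - by rewrite divr_gt0// exprn_gt0// !addr_gt0.
  rewrite ler_pdivrMr//.
  apply: (@le_trans _ _ ((3 * e) ^+ d.+1)).
    by rewrite lerXn2r ?nnegrE ?addr_ge0 ?mulr_ge0 ?(ltW r0) ?(ltW e0)//; lra.
  rewrite exprMn [e ^+ d.+1]exprSr.
  have : e / 2 <= r by move: rn1; rewrite exprSr.
  have : 0 <= 3 ^+ d.+1 * e ^+ d by rewrite mulr_ge0 ?exprn_ge0 ?(ltW e0).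
  set A := 3 ^+ d.+1; set B := e ^+ d => AB er.
  have -> : A * (B * e) = A * B * e by ring.
  have -> : 2 * A * B * r = A * B * (2 * r) by ring.
  by apply: ler_wpM2l => //; lra.
have k2 : x^-1 * 2 `^ (n%:R * (d%:R * (1 - th))) <= @cap_height R d n q.
  rewrite /cap_height cq; apply: ler_pM; rewrite ?invr_ge0 ?powR_ge0 ?exprn_ge0//.
    rewrite -invfM lef_pV2 ?posrE ?mulr_gt0 ?exprn_gt0//.
    have : n.+1%:R <= n.+2%:R :> R by rewrite ler_nat.
    have : 0 <= n.+1%:R :> R by [].
    rewrite /x; move: (n.+1%:R : R) (n.+2%:R : R) => a b a0 ab.
    have a2 : a ^+ 2 <= b ^+ 2 by rewrite lerXn2r ?nnegrE// (le_trans a0).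
    have ab2 : a * b <= b ^+ 2 by rewrite expr2 ler_wpM2r// (le_trans a0).
    have -> : b ^+ 4 = b ^+ 2 * b ^+ 2 by ring.
    by apply: ler_pM; rewrite ?exprn_ge0 ?mulr_ge0// (le_trans a0).
  rewrite -!exprM -!powR_mulrn// -powRB; last by rewrite pnatr_eq0 implybT.
  apply: ler_powR; first by rewrite ler1n.
  rewrite !natrM mulrCA -[leRHS]mulrBl [leRHS]mulrC ler_wpM2l//.
  have /andP[h _] : (Num.truncn (n%:R * th))%:R <= n%:R * th < (Num.truncn (n%:R * th)).+1%:R.
    by apply: truncn_itv; rewrite mulr_ge0.
  lra.
have ed : 0 < e ^+ d by rewrite exprn_gt0.
have h0 : 0 <= c / (2 * 3 ^+ d.+1) by rewrite divr_ge0 ?mulr_ge0 ?exprn_ge0// ltW.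
have := ler_pM _ _ k1 k2.
rewrite !mulr_ge0 ?invr_ge0 ?mulr_ge0 ?exprn_ge0 ?(ltW e0) ?powR_ge0// => /(_ isT isT).
move=> /(ler_wpM2l (_ : 0 <= c * e ^+ d)).
rewrite mulr_ge0 ?(ltW c0) ?(ltW ed)// => /(_ isT) h.
apply: le_trans (le_trans _ h) _; rewrite le_eqVlt; apply/orP; left; apply/eqP.
  have A0 : 3 ^+ d.+1 != 0 :> R by rewrite expf_neq0.
  have x0 : x != 0 by rewrite expf_neq0.
  move: A0 x0; set A := 3 ^+ d.+1; set B := e ^+ d in ed *; set P := 2 `^ _.
  move=> A0 x0; field; by rewrite A0 x0 gt_eqF.
ring.
Qed.

Lemma beta_plus_saturating (th : R) (t : 'rV[R]_d) : 0 <= th <= 1 ->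
  (forall i, 0 <= t ord0 i < 1) ->
  ((d%:R * (1 - th))%:E <= beta_plus f (coded_point (pattern th) t))%E.
Proof.
move=> th01 t01; have [K K0 hK] := poisson_saturating_coded_ge th01.
apply/beta_plus_geP => b; set beta := d%:R * (1 - th) => bb.
have bb0 : 0 < beta - b by rewrite subr_gt0.
have K2 : 0 <= 2 `^ `|b| / K by rewrite divr_ge0 ?powR_ge0// ltW.
have [n0 hn0] := poly_le_powR2 bb0 K2.
exists (2^-1 ^+ n0); first by rewrite exprn_gt0 ?invr_gt0.
move=> r /andP[r0 rn0].
have e1 : 2^-1 ^+ n0 <= 1 :> R by rewrite exprn_ile1// invf_le1// ler1n.
have [|n /andP[rn1 rn2]] := @expr2_bracket R r.
  by rewrite r0 (le_trans (ltW rn0)).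
have nn0 : (n0 <= n)%N.
  rewrite leqNgt; apply/negP => nn0.
  have : 2^-1 ^+ n0 <= 2^-1 ^+ n.+1 :> R by rewrite ler_wiXn2l// invf_le1// ler1n.
  by move=> /(lt_le_trans rn0)/(lt_trans rn1); rewrite ltxx.
apply: le_trans (ler_norm _); apply: le_trans (hK t n r t01 _); last first.
  by rewrite (ltW rn1) rn2.
apply: le_trans (powR_dyadic_le (del := 2^-1 ^+ n) _ r0 _) _.
  by rewrite rn2 andbT -exprSr ltW.
rewrite normrN -powR_mulrn// -powRrM.
have -> : 2^-1 `^ (n%:R * - b) = 2 `^ (n%:R * b) :> R.
  by rewrite -powR_inv1// -powRrM; congr (_ `^ _); ring.
have := hn0 n nn0; rewrite mulrBr powRB; last by rewrite pnatr_eq0 implybT.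
set A := 2 `^ (n%:R * b); set B := 2 `^ (n%:R * beta); set C := 2 `^ `|b|.
have A0 : 0 < A by rewrite powR_gt0.
have x0 : 0 < n.+2%:R ^+ 4 :> R by rewrite exprn_gt0.
set x := n.+2%:R ^+ 4 in x0 *.
rewrite ler_pdivlMr// => h.
rewrite mulrAC ler_pdivlMr// -ler_pdivrMl//.
by apply: le_trans h; rewrite le_eqVlt; apply/orP; left; apply/eqP; ring.
Qed.

End growth_on_cantor_sets.

(** * Growth almost everywhere on the Cantor sets *)

Section upper_bound_almost_everywhere.
Context (R : realType) (d : nat).
Hypothesis d_gt0 : (0 < d)%N.
Local Notation S := (esphere R d.+1).
Local Notation sigma := (sphere_measure R d.+1).
Local Notation V := (@rV_lebesgue R d).
Local Notation unit_cube := [set t : 'rV[R]_d | forall i, 0 <= t ord0 i < 1].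

Definition large_growth (f : 'rV[R]_d.+1 -> R) (b : R) n : set 'rV[R]_d.+1 :=
  [set x | S x /\ exists2 r, 2^-1 ^+ n.+1 < r <= 2^-1 ^+ n &
    r `^ (- b) < `|poisson_integral f ((1 - r) *: x)|].

Lemma large_growth_cover f (b e : R) : L1_sphere f -> 0 < e ->
  exists2 C : R, 0 < C & forall n, exists N (c : nat -> 'rV[R]_d.+1),
    N%:R <= C * (2^-1 ^+ n) `^ (- (d%:R + e - b)) /\
    large_growth f b n `<=` \bigcup_(i < N) eclosed_ball (c i) (2 * 2^-1 ^+ n).
Proof.
move=> L1f e0; have [C0 C00 hC] := packing_poisson_le d e0.
have /integrableP[mf foo] := L1f.
set M := (\int[sigma]_(xi in S) `|f xi|%:E)%E.
have Mfin : M \is a fin_num.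
  by rewrite ge0_fin_numE//; exact: integral_ge0.
set a := d%:R + e - b.
pose C := C0 * fine M * 2 `^ `|a|.
have C_ge0 : 0 <= C.
  by rewrite !mulr_ge0 ?powR_ge0 ?(ltW C00)// fine_ge0// integral_ge0.
exists (C + 1) => [|n]; first by rewrite ltr_wpDl.
set del := 2^-1 ^+ n; have del0 : 0 < del by rewrite exprn_gt0 ?invr_gt0.
have del1 : del <= 1 by rewrite exprn_ile1// invf_le1// ler1n.
have bound N (c : nat -> 'rV[R]_d.+1) : (forall i, (i < N)%N -> large_growth f b n (c i)) ->
    trivIset `I_N (fun i => eclosed_ball (c i) del) -> N%:R <= C * del `^ (- a).
  move=> Fc tc.
  have /choice[r hr] : forall i, exists r, (i < N)%N ->
      2^-1 ^+ n.+1 < r <= 2^-1 ^+ n /\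
      r `^ (- b) < `|poisson_integral f ((1 - r) *: c i)|.
    move=> i; have [iN|_] := boolP (i < N)%N; last by exists 0.
    by have [_ [r h1 h2]] := Fc i iN; exists r.
  have r0 i : (i < N)%N -> 0 < r i.
    move=> /hr[/andP[h _] _]; apply: lt_trans h; by rewrite exprn_gt0 ?invr_gt0.
  have rdel i : (i < N)%N -> r i <= del by move=> /hr[/andP[_ h] _].
  (* The radius [r i] of large growth varies with the point but is at most [del], so the shrunken
     balls remain disjoint. *)
  have pk : ball_packing (iota 0 N) c r.
    split; first exact: iota_uniq.
      move=> i; rewrite mem_iota/= add0n => iN; have [Sc _] := Fc i iN.
      by split => //; rewrite r0//= (le_trans (rdel i iN)).
    apply/trivIsetP => i j; rewrite /= !mem_iota/= !add0n => iN jN ij.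
    apply/seteqP; split => // z [zi zj].
    move/trivIsetP : tc => /(_ i j iN jN ij) <-.
    by split; rewrite /eclosed_ball/=; [apply: le_trans zi _|apply: le_trans zj _];
      exact: rdel.
  have := hC f _ _ _ L1f pk; rewrite sumEFin -/M -(fineK Mfin) -EFinM lee_fin => key.
  have : \sum_(i <- iota 0 N) (del `^ a / 2 `^ `|a|) <= C0 * fine M.
    apply: le_trans key; rewrite big_seq [leRHS]big_seq; apply: ler_sum => i.
    rewrite mem_iota/= add0n => iN; have [/andP[h1 h2] h3] := hr i iN.
    have ri0 := r0 i iN.
    apply: (@le_trans _ _ (r i `^ (d%:R + e) * r i `^ (- b))); last first.
      by rewrite ler_wpM2l ?powR_ge0// ltW.
    rewrite -powRD_gt0// -/a.
    have : r i `^ (- a) <= del `^ (- a) * 2 `^ `|- a|.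
      by apply: powR_dyadic_le => //; rewrite h2 andbT -exprSr ltW.
    rewrite normrN !powRN -lef_pV2 ?posrE ?mulr_gt0 ?invr_gt0 ?powR_gt0//.
    by rewrite invrK invfM invrK.
  rewrite big_const_seq count_predT size_iota iter_addr_0 -[leLHS]mulr_natl.
  rewrite mulrA ler_pdivrMr ?powR_gt0// -/C powRN => h.
  by rewrite ler_pdivlMr ?powR_gt0.
have [N c Fc tc|N [c [Fc tc Fcov]]] :=
    @maximal_disjoint_cover R d.+1 del (large_growth f b n) (Num.truncn (C * del `^ (- a))).
  have h := bound N c Fc tc; rewrite truncn_ge_nat//.
  exact: le_trans (ler0n _ _) h.
exists N, c; split => //; apply: le_trans (bound N c Fc tc) _.
by rewrite ler_wpM2r ?powR_ge0// lerDl.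
Qed.

Context (th : R).
Hypothesis th01 : 0 < th <= 1.
Local Notation X := (coded_point (pattern th)).

(* The image of Lebesgue measure under [X] has Frostman exponent [d * th]. *)
Lemma coded_point_frostman : exists2 C : R, 0 < C & forall U D, 0 <= D ->
  (ediam U <= D%:E)%E -> exists Q, [/\ measurable Q,
    (V Q <= (C * D `^ (d%:R * th))%:E)%E &
    unit_cube `&` [set t | U (X t)] `<=` Q].
Proof.
have d0 : 0 < d%:R :> R by rewrite ltr0n.
have /andP[th0 th1] := th01.
exists ((16 * (2 * d%:R) `^ th) ^+ d) => [|U D D0 UD].
  by rewrite exprn_gt0// mulr_gt0// powR_gt0// mulr_gt0.
pose a := 8 * (2 * d%:R * D) `^ th.
have a0 : 0 <= a by rewrite mulr_ge0 ?powR_ge0.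
have vol t : V (cube t a) = ((16 * (2 * d%:R) `^ th) ^+ d * D `^ (d%:R * th))%:E.
  rewrite rV_lebesgue_cube//; congr (_%:E).
  have dd0 : 0 <= 2 * d%:R :> R by rewrite mulr_ge0.
  rewrite /a (powRM _ dd0 D0).
  rewrite [d%:R * th]mulrC powRrM powR_mulrn ?powR_ge0//.
  by rewrite -exprMn; congr (_ ^+ _); ring.
have [[t [t01 Ut]]|none] := pselect (exists t, unit_cube t /\ U (X t)).
  exists (cube t a); split; [exact: measurable_cube|by rewrite [leLHS]vol|].
  move=> u [u01 Uu] i; have := t01 i; have := u01 i => u01i t01i.
  apply: le_trans (code_hoelder th01 u01i t01i) _; rewrite /a ler_wpM2l//.
  apply: ge0_ler_powR; rewrite ?nnegrE ?normr_ge0 ?mulr_ge0 ?(ltW th0)//.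
  have := chart_expand d_gt0 (\row_i code (pattern th) (u ord0 i))
    (\row_i code (pattern th) (t ord0 i)) i.
  rewrite !mxE => h; apply: le_trans h _; rewrite ler_wpM2l ?mulr_ge0//.
  rewrite -lee_fin; apply: le_trans UD; apply: ereal_sup_ubound.
  by exists (X u) => //; exists (X t).
exists (cube 0 a); split; [exact: measurable_cube|by rewrite [leLHS]vol|].
by move=> u [u01 Uu]; exfalso; apply: none; exists u.
Qed.

(** About [2^(n(d + eta/2 - b))] balls are needed, each with a preimage of measure of order
    [2^(-n d th)]. As [b = d(1 - th) + eta], the product is [q^n] with [q = 2^(-eta/2)], which is
    summable. *)
Lemma large_growth_eventually_not f (eta : R) : L1_sphere f -> 0 < eta ->
  exists Z, [/\ measurable Z, V Z = 0%E & forall t, unit_cube t -> ~ Z t ->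
    exists n0, forall n, (n0 <= n)%N ->
      ~ large_growth f (d%:R * (1 - th) + eta) n (X t)].
Proof.
move=> L1f eta0; have eta20 : 0 < eta / 2 by rewrite divr_gt0.
set b := d%:R * (1 - th) + eta.
have [C C0 hC] := large_growth_cover b L1f eta20.
have [F F0 hF] := coded_point_frostman.
pose q : R := 2^-1 `^ (eta / 2).
have q0 : 0 <= q by rewrite powR_ge0.
have q1 : q < 1.
  have p1 : 1 `^ (eta / 2) = 1 :> R by rewrite powR1.
  rewrite -[ltRHS]p1; apply: gt0_ltr_powR => //; rewrite ?nnegrE//.
  by rewrite invf_lt1// ltr1n.
pose K := C * (F * 4 `^ (d%:R * th)).
have K0 : 0 <= K by rewrite !mulr_ge0 ?powR_ge0// ltW.
have /choice[D hD] : forall n, exists D, [/\ measurable D, (V D <= (K * q ^+ n)%:E)%E &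
    unit_cube `&` [set t | large_growth f b n (X t)] `<=` D].
  move=> n; have [N [c [hN cov]]] := hC n.
  set del := 2^-1 ^+ n in hN cov; have del0 : 0 < del by rewrite exprn_gt0 ?invr_gt0.
  have /choice[Q hQ] : forall i, exists Q, [/\ measurable Q,
      (V Q <= (F * (4 * del) `^ (d%:R * th))%:E)%E &
      unit_cube `&` [set t | eclosed_ball (c i) (2 * del) (X t)] `<=` Q].
    move=> i; apply: hF; first by rewrite mulr_ge0 ?(ltW del0).
    apply: le_trans (ediam_eclosed_ball _ _) _; rewrite lee_fin; lra.
  exists (\big[setU/set0]_(i < N) Q i); split.
  - by apply: bigsetU_measurable => i _; have [] := hQ i.
  - apply: le_trans (Boole_inequality V _) _.
      by move=> i _; have [] := hQ i.
    apply: (@le_trans _ _ (\sum_(i < N) (F * (4 * del) `^ (d%:R * th))%:E)%E).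
      by apply: lee_sum => i _; have [] := hQ i.
    rewrite sumEFin sumr_const card_ord lee_fin -[leLHS]mulr_natl.
    have W0 : 0 <= F * (4 * del) `^ (d%:R * th) by rewrite mulr_ge0 ?powR_ge0// ltW.
    apply: le_trans (ler_wpM2r W0 hN) _.
    rewrite le_eqVlt; apply/orP; left; apply/eqP.
    rewrite powRM ?(ltW del0)//.
    have -> : q ^+ n = del `^ (- (d%:R + eta / 2 - b)) * del `^ (d%:R * th).
      have dE : del = 2^-1 `^ n%:R by rewrite powR_mulrn.
      rewrite -powRD_gt0// -(powR_mulrn n q0) /q -powRrM dE -powRrM.
      by congr (_ `^ _); rewrite /b; field.
    by rewrite /K; ring.
  - move=> t [t01 /cov[i iN Bi]]; rewrite -bigcup_mkord; exists i => //.
    by have [_ _] := hQ i; apply.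
(* The limsup of the measurable enclosures is used, as the sets of parameters with large growth are
   not known to be measurable. *)
exists (lim_sup_set D); split.
- by apply: bigcap_measurableType => k _; apply: bigcup_measurable => j _; have [] := hD j.
- apply: lim_sup_set_cvg0 => [k|]; first by have [] := hD k.
  apply: (@le_lt_trans _ _ (K * (1 - q)^-1)%:E); last exact: ltry.
  apply: lime_le; first exact: is_cvg_nneseries.
  apply: nearW => N; rewrite big_mkord.
  apply: (@le_trans _ _ (\sum_(k < N) (K * q ^+ k)%:E)%E).
    by apply: lee_sum => k _; have [] := hD k.
  rewrite sumEFin lee_fin -mulr_sumr ler_wpM2l// sum_geometric_le// q0//.
move=> t t01 Zt; apply: contrapT => none; apply: Zt => n _.
have [m [nm hm]] : exists m, (n <= m)%N /\ large_growth f b m (X t).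
  apply: contrapT => h; apply: none; exists n => m nm hm; apply: h; by exists m.
by exists m => //; have [_ _] := hD m; apply.
Qed.

Lemma beta_minus_coded_point_le f : L1_sphere f -> exists Z, [/\ measurable Z,
  V Z = 0%E & forall t, unit_cube t -> ~ Z t ->
    (beta_minus f (X t) <= (d%:R * (1 - th))%:E)%E].
Proof.
move=> L1f; have /choice[Z hZ] : forall k : nat, exists Z, [/\ measurable Z, V Z = 0%E &
    forall t, unit_cube t -> ~ Z t -> exists n0, forall n, (n0 <= n)%N ->
      ~ large_growth f (d%:R * (1 - th) + k.+1%:R^-1) n (X t)].
  by move=> k; apply: large_growth_eventually_not => //; rewrite invr_gt0.
exists (\bigcup_k Z k); split.
- by apply: bigcup_measurable => k _; have [] := hZ k.
- apply/eqP; rewrite eq_le measure_ge0 andbT.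
  apply: le_trans (generalized_Boole_inequality _ _ _) _.
  + by move=> k; have [] := hZ k.
  + by apply: bigcup_measurable => k _; have [] := hZ k.
  + by rewrite eseries0// => k _ _; have [] := hZ k.
move=> t t01 Zt; apply/beta_minus_leP => b bb.
set beta := d%:R * (1 - th) in hZ bb.
pose k := Num.truncn (b - beta)^-1.
have kb : beta + k.+1%:R^-1 <= b.
  rewrite -lerBrDl invf_ple ?posrE ?subr_gt0//.
  have /andP[_ h] : k%:R <= (b - beta)^-1 < k.+1%:R.
    by apply: truncn_itv; rewrite invr_ge0 subr_ge0 ltW.
  exact: ltW.
have [_ _ /(_ t t01)] := hZ k; case=> [Zkt|n0 hn0].
  by apply: Zt; exists k.
exists (2^-1 ^+ n0); first by rewrite exprn_gt0 ?invr_gt0.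
move=> r /andP[r0 rn0].
have e1 : 2^-1 ^+ n0 <= 1 :> R by rewrite exprn_ile1// invf_le1// ler1n.
have r1 : r <= 1 by exact: le_trans (ltW rn0) e1.
have [|n /andP[rn1 rn2]] := @expr2_bracket R r; first by rewrite r0 r1.
have nn0 : (n0 <= n)%N.
  rewrite leqNgt; apply/negP => nn0.
  have : 2^-1 ^+ n0 <= 2^-1 ^+ n.+1 :> R by rewrite ler_wiXn2l// invf_le1// ler1n.
  by move=> /(lt_le_trans rn0)/(lt_trans rn1); rewrite ltxx.
apply: le_trans (_ : r `^ (- (beta + k.+1%:R^-1)) <= _); last first.
  by apply: ger_powR; rewrite ?r0// lerN2.
rewrite leNgt; apply/negP => bad; apply: (hn0 n nn0); split.
  exact: coded_point_esphere.
by exists r; rewrite ?rn1.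
Qed.

(* If [E] were null, the unit cube of codes would be, up to the null set [Z],
   covered by cubes of small total volume. *)
Lemma hausdorff_dim_ge_frostman E (Z : set 'rV[R]_d) : measurable Z -> V Z = 0%E ->
  (forall t, unit_cube t -> ~ Z t -> E (X t)) ->
  ((d%:R * th)%:E <= hausdorff_dim E)%E.
Proof.
move=> mZ Z0 ZE; apply: le_ereal_inf_tmp => _ [s [s0 Es] <-].
rewrite lee_fin leNgt; apply/negP => sd.
have [F F0 hF] := coded_point_frostman.
have sd0 : 0 < d%:R * th by exact: le_lt_trans sd.
(* Chosen so that [F eps] is half the volume of the test cube [T]. *)
pose eps := (2^-1 ^+ d) / (2 * F) : R.
have eps0 : 0 < eps by rewrite divr_gt0 ?mulr_gt0 ?exprn_gt0 ?invr_gt0.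
(* Diameters at most 1 give [D^(d th) <= D^s] for [s < d th]. *)
have [U [U1 EU Ueps]] := hausdorff_measure0_cover ltr01 eps0 Es.
have /choice[Q hQ] : forall i, exists Q, [/\ measurable Q,
    (V Q <= F%:E * diam_gauge s (U i))%E & unit_cube `&` [set t | U i (X t)] `<=` Q].
  move=> i; have [Ui0|/eqP/set0P Ui0] := pselect (U i = set0).
    exists set0; rewrite Ui0; split; [by []| |by move=> t []].
    by rewrite measure0 mule_ge0 ?diam_gauge_ge0// lee_fin ltW.
  have D0 := ediam_ge0 Ui0; have D1 := U1 i.
  have Dfin : ediam (U i) \is a fin_num by rewrite ge0_fin_numE// (le_lt_trans D1)// ltry.
  have [|//|Q [mQ VQ subQ]] := hF (U i) (fine (ediam (U i))).
  - by rewrite fine_ge0.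
  - by rewrite fineK.
  exists Q; split => //; apply: le_trans VQ _.
  rewrite /diam_gauge; case: asboolP => [Ui|_]; first by case: Ui0 => x; rewrite Ui.
  rewrite -(fineK Dfin) poweR_EFin -EFinM lee_fin ler_wpM2l ?(ltW F0)//.
  have f0 : 0 <= fine (ediam (U i)) by rewrite fine_ge0.
  have f1 : fine (ediam (U i)) <= 1 by rewrite -lee_fin fineK.
  move: f0; rewrite le_eqVlt => /predU1P[<-|f0]; last first.
    by apply: ger_powR; [rewrite f0|exact: ltW].
  by rewrite powR0 ?powR_ge0// gt_eqF.
(* The closed cube [[0, 1/2]^d], inside the half-open unit cube of parameters. *)
pose T : set 'rV[R]_d := cube (\row_i 4^-1) 4^-1.
have T01 : T `<=` unit_cube.
  move=> t Tt i; have := Tt i; rewrite mxE ler_distl => /andP[h1 h2].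
  by apply/andP; split; lra.
have VT : V T = (2^-1 ^+ d)%:E.
  by rewrite rV_lebesgue_cube//; congr ((_ ^+ _)%:E); field.
have TU : T `<=` Z `|` \bigcup_i Q i.
  move=> t /T01 t01; have [Zt|Zt] := pselect (Z t); [by left|right].
  have [i _ Ui] := EU _ (ZE t t01 Zt); exists i => //.
  by have [_ _] := hQ i; apply.
have mQ : measurable (\bigcup_i Q i).
  by apply: bigcup_measurable => i _; have [] := hQ i.
have : (V T <= (F * eps)%:E)%E.
  apply: (@le_trans _ _ (V (Z `|` \bigcup_i Q i))).
    apply: le_measure TU; rewrite inE; first exact: measurable_cube.
    exact: measurableU.
  apply: le_trans (measureU2 _ _ _) _ => //; rewrite [X in (X + _)%E]Z0 add0e.
  apply: le_trans (generalized_Boole_inequality _ _ _) _ => //.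
    by move=> i; have [] := hQ i.
  apply: (@le_trans _ _ (\sum_(0 <= i <oo) F%:E * diam_gauge s (U i))%E).
    by apply: lee_nneseries => // i _; have [] := hQ i.
  rewrite nneseriesZl; last by move=> i _; exact: diam_gauge_ge0.
  by rewrite EFinM lee_pmul2l ?lte_fin// ltW.
rewrite VT lee_fin /eps.
have -> : F * (2^-1 ^+ d / (2 * F)) = 2^-1 ^+ d / 2 by field; rewrite gt_eqF.
have : 0 < 2^-1 ^+ d :> R by rewrite exprn_gt0 ?invr_gt0.
by set y := 2^-1 ^+ d => y0; lra.
Qed.

End upper_bound_almost_everywhere.

(** * Dimensions of the level sets of the saturating function *)

Lemma hausdorff_dim_ge0 (R : realType) n (E : set 'rV[R]_n) : (0 <= hausdorff_dim E)%E.
Proof. by apply: le_ereal_inf_tmp => _ [s [s0 _] <-]. Qed.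

(** The slope solves [d (1 - th) = b]. The case [b = d] is separate: it would give [th = 0], where
    decoding has no Hoelder exponent, but there the bound is 0. *)
Lemma hausdorff_dim_level_set_saturating (R : realType) d (b : R) : (0 < d)%N ->
  0 <= b <= d%:R ->
  ((d%:R - b)%:E <= hausdorff_dim (level_set b (@saturating R d)))%E.
Proof.
move=> d_gt0 /andP[b0]; rewrite le_eqVlt => /predU1P[->|bd].
  by rewrite subrr hausdorff_dim_ge0.
have d0 : 0 < d%:R :> R by rewrite ltr0n.
pose th := 1 - b / d%:R.
have th01 : 0 < th <= 1.
  by rewrite subr_gt0 ltr_pdivrMr// mul1r bd gerBl divr_ge0// ltW.
have dth : d%:R * th = d%:R - b by rewrite /th; field; rewrite gt_eqF.
have dth1 : d%:R * (1 - th) = b by rewrite /th; field; rewrite gt_eqF.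
have [Z [mZ Z0 hZ]] := beta_minus_coded_point_le d_gt0 th01 (saturating_L1 R d_gt0).
rewrite -dth; apply: (hausdorff_dim_ge_frostman d_gt0 th01 mZ Z0) => t t01 Zt.
have th01' : 0 <= th <= 1 by case/andP: th01 => /ltW -> ->.
have hp := beta_plus_saturating d_gt0 th01' t01; have hm := hZ t t01 Zt.
rewrite dth1 in hp hm.
have hpm := beta_plus_le_minus (@saturating R d) (coded_point (pattern th) t).
split; first exact: coded_point_esphere.
- by apply/eqP; rewrite eq_le hp (le_trans hpm hm).
- by apply/eqP; rewrite eq_le hm (le_trans hp hpm).
Qed.

Theorem theorem1p2 (R : realType) (d : nat) (hd : (1 <= d)%N) :
  (forall f : 'rV[R]_d.+1 -> R, L1_sphere f ->
     forall beta : R, 0 <= beta <= d%:R ->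
       (packing_dim (level_set_plus_ge beta f) <= (d%:R - beta)%:E)%E)
  /\
  (exists f : 'rV[R]_d.+1 -> R,
     [/\ L1_sphere f,
         (forall x, esphere R d.+1 x -> 0 <= f x),
         (forall beta : R, 0 <= beta <= d%:R ->
            hausdorff_dim (level_set beta f) = (d%:R - beta)%:E /\
            packing_dim (level_set beta f) = (d%:R - beta)%:E)
       & (forall beta : R, 0 <= beta <= d%:R ->
            packing_dim (level_set_plus beta f) = (d%:R - beta)%:E)]).
Proof.
split=> [f L1f beta /andP[_ bd]|]; first exact: packing_dim_level_set_plus_ge.
have L1f := saturating_L1 R hd.
exists (@saturating R d).
have sub1 beta : level_set beta (@saturating R d) `<=` level_set_plus beta (@saturating R d).
  by move=> x [].
have sub2 beta : level_set_plus beta (@saturating R d) `<=`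
    level_set_plus_ge beta (@saturating R d).
  by move=> x [Sx bx]; split => //; rewrite bx.
(* Each dimension is squeezed between the Frostman lower bound for the smallest set and part (i) for
   the largest. *)
have chain beta : 0 <= beta <= d%:R -> let f := @saturating R d in
    [/\ hausdorff_dim (level_set beta f) = (d%:R - beta)%:E,
        packing_dim (level_set beta f) = (d%:R - beta)%:E &
        packing_dim (level_set_plus beta f) = (d%:R - beta)%:E].
  move=> b01 f; have /andP[_ bd] := b01.
  have h1 := hausdorff_dim_level_set_saturating hd b01.
  have h2 : (hausdorff_dim (level_set beta f) <= packing_dim (level_set beta f))%E.
    exact: hausdorff_dim_le_packing.
  have h3 : (packing_dim (level_set beta f) <= packing_dim (level_set_plus beta f))%E.
    exact: le_packing_dim.
  have h4 : (packing_dim (level_set_plus beta f) <= (d%:R - beta)%:E)%E.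
    apply: le_trans (packing_dim_level_set_plus_ge L1f bd); exact: le_packing_dim.
  have h12 := le_trans h1 h2; have h34 := le_trans h3 h4.
  split; apply/eqP; rewrite eq_le.
  - by rewrite h1 (le_trans h2 h34).
  - by rewrite h34 h12.
  - by rewrite h4 (le_trans h12 h3).
split=> //.
- by move=> x _; exact: saturating_ge0.
- by move=> beta /chain[].
- by move=> beta /chain[].
Qed.
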